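(* Let $n\ge1$ and let $f$ be a germ of meromorphic function at $(\underline 0,0)$ in $\mathbb C^{n+1}$. Assume that $f(\underline 0,w)$ is a well-defined and non constant germ of meromorphic function at $w=0$. Then, up to an analytic change of the $w$-coordinate $w:=\phi(\underline z,w)$, the function $f$ becomes a $w$-rational function $$f(\underline z,w)=\frac{f_0(\underline z)+f_1(\underline z)w+\cdots+f_{k_0-1}(\underline z)w^{k_0-1}+w^{k_0}}{g_0(\underline z)+g_1(\underline z)w+\cdots+g_{k_\infty-1}(\underline z)w^{k_\infty-1}+w^{k_\infty}}$$ where $k_0,k_\infty\in\mathbb N$ and $f_i,g_j\in\mathbb C\{\underline z\}$.
   Context: The coordinates on $\mathbb C^{n+1}$ are $(\underline z,w)$ with $\underline z=(z_1,\ldots,z_n)$. $\mathbb C\{\underline z\}$ denotes the ring of convergent power series in $\underline z$. $\mathbb N=\{0,1,2,\ldots\}$. An analytic change of the $w$-coordinate is a germ of biholomorphism of $(\mathbb C^{n+1},0)$ of the form $(\underline z,w)\mapsto(\underline z,\phi(\underline z,w))$, leaving $\underline z$ unchanged. That $f(\underline 0,w)$ is well defined means that, writing $f=p/q$ with $p,q$ coprime germs of holomorphic functions, $q(\underline 0,w)\not\equiv0$. *)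

(* Defs.v *)
(* Germs of holomorphic functions at the origin of K^m are represented by their
   Taylor series: absolutely convergent power series with coefficients in K.
   They form an integral domain [germ K m], whose field of fractions
   [{fraction germ K m}] is the field of germs of meromorphic functions.
   Everything is set up over a numFieldType; K = R[i] gives the complex case.
   Multi-indices 'X_{1..m} and polynomials come from multinomials' mpoly;
   [mdeg] is the total degree of a multi-index. *)
From HB Require Import structures.
From mathcomp Require Import all_boot all_order all_algebra.
From mathcomp Require Import boolp reals complex.
From mathcomp Require Import ssrcomplements mpoly.

Set Implicit Arguments.
Unset Strict Implicit.
Unset Printing Implicit Defensive.

Import Order.TTheory GRing.Theory Num.Theory.
Local Open Scope ring_scope.

Section Convergence.
Variables (K : numFieldType) (m : nat).
Implicit Types (a b : 'X_{1..m} -> K) (p q : {mpoly K[m]}).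

(* The series is absolutely convergent on some closed polydisc of radius r > 0
   (all partial sums of the nonnegative series are bounded). *)
Definition convergent a : Prop :=
  exists r M : K, 0 < r /\
    forall d : nat, \sum_(k : 'X_{1..m < d}) `|a k| * r ^+ mdeg k <= M.

Definition trunc (d : nat) a : {mpoly K[m]} :=
  \sum_(k : 'X_{1..m < d}) a k *: 'X_[k].

Lemma mcoeff_trunc d a k : (mdeg k < d)%N -> (trunc d a)@_k = a k.
Proof. exact: mcoeff_mpoly. Qed.

Lemma mcoeff_trunc_ge d a k : (d <= mdeg k)%N -> (trunc d a)@_k = 0.
Proof.
move=> dk; rewrite /trunc raddf_sum big1 //= => i _.
rewrite mcoeffZ mcoeffX; case: eqP => [ik|_]; last by rewrite mulr0.
by move: (bmdeg i); rewrite ik ltnNge dk.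
Qed.

Lemma msize_trunc d a : (msize (trunc d a) <= d)%N.
Proof.
rewrite msizeE; apply/bigmax_leqP_seq => k; rewrite mcoeff_msupp => + _.
by rewrite ltnNge; apply: contra => /mcoeff_trunc_ge ->.
Qed.

Definition pnorm (r : K) p : K := \sum_(k <- msupp p) `|p@_k| * r ^+ mdeg k.

Lemma pnormE r p d : (msize p <= d)%N ->
  pnorm r p = \sum_(k : 'X_{1..m < d}) `|p@_k| * r ^+ mdeg k.
Proof.
move=> le_pd; rewrite /pnorm (big_mksub 'X_{1..m < d}) ?msupp_uniq //=; first last.
  by move=> x /msize_mdeg_lt /leq_trans; apply.
rewrite big_rmcond //= => i /memN_msupp_eq0 ->.
by rewrite normr0 mul0r.
Qed.

Lemma pnorm_trunc r d a :
  pnorm r (trunc d a) = \sum_(k : 'X_{1..m < d}) `|a k| * r ^+ mdeg k.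
Proof.
rewrite (pnormE _ (msize_trunc d a)); apply: eq_bigr => k _.
by rewrite mcoeff_trunc // bmdeg.
Qed.

Lemma pnorm_ge0 r p : 0 <= r -> 0 <= pnorm r p.
Proof. by move=> r0; apply: sumr_ge0 => k _; rewrite mulr_ge0 ?exprn_ge0. Qed.

Lemma sum_le_pnorm r p d : 0 <= r ->
  \sum_(k : 'X_{1..m < d}) `|p@_k| * r ^+ mdeg k <= pnorm r p.
Proof.
move=> r0; pose q := trunc d (fun k => p@_k).
have -> : \sum_(k : 'X_{1..m < d}) `|p@_k| * r ^+ mdeg k = pnorm r q.
  by rewrite pnorm_trunc.
have le1 := leq_maxl (msize p) d; have le2 := leq_maxr (msize p) d.
rewrite (pnormE _ le1) (pnormE _ (leq_trans (msize_trunc d _) le2)).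
apply: ler_sum => k _; case: (ltnP (mdeg k) d) => kd.
  by rewrite mcoeff_trunc.
by rewrite mcoeff_trunc_ge // normr0 mul0r mulr_ge0 ?exprn_ge0.
Qed.

Lemma pnorm0 r : pnorm r 0 = 0.
Proof. by rewrite /pnorm msupp0 big_nil. Qed.

Lemma pnormD r p q : 0 <= r -> pnorm r (p + q) <= pnorm r p + pnorm r q.
Proof.
move=> r0; pose d := maxn (msize p) (msize q).
have le1 : (msize p <= d)%N by apply: leq_maxl.
have le2 : (msize q <= d)%N by apply: leq_maxr.
have le3 : (msize (p + q) <= d)%N by apply: mmeasureD_le.
rewrite (pnormE _ le1) (pnormE _ le2) (pnormE _ le3) -big_split /=.
apply: ler_sum => k _.
by rewrite -mulrDl mcoeffD ler_wpM2r ?exprn_ge0 ?ler_normD.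
Qed.

Lemma pnorm_sum r (I : Type) (s : seq I) (F : I -> {mpoly K[m]}) : 0 <= r ->
  pnorm r (\sum_(i <- s) F i) <= \sum_(i <- s) pnorm r (F i).
Proof.
move=> r0; elim: s => [|i s IH]; first by rewrite !big_nil pnorm0.
by rewrite !big_cons (le_trans (pnormD _ _ r0)) // lerD2l.
Qed.

Lemma pnormZ r c p : pnorm r (c *: p) = `|c| * pnorm r p.
Proof.
have le1 : (msize (c *: p) <= msize p)%N by apply: msizeZ_le.
rewrite (pnormE _ le1) (pnormE r (leqnn (msize p))) mulr_sumr.
by apply: eq_bigr => k _; rewrite mcoeffZ normrM mulrA.
Qed.

Lemma pnormX r k : pnorm r 'X_[k] = r ^+ mdeg k.
Proof. by rewrite /pnorm msuppX big_seq1 mcoeffX eqxx normr1 mul1r. Qed.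

Lemma pnorm1 r : pnorm r 1 = 1.
Proof. by rewrite -mpolyX0 pnormX mdeg0 expr0. Qed.

Lemma pnormXM r k p : 0 <= r ->
  pnorm r ('X_[k] * p) <= r ^+ mdeg k * pnorm r p.
Proof.
move=> r0; rewrite {1}(mpolyE p) mulr_sumr (le_trans (pnorm_sum _ _ r0)) //.
rewrite /pnorm mulr_sumr -!/(pnorm _ _); apply: ler_sum => l _.
by rewrite -scalerAr -mpolyXD -/(pnorm _ _) pnormZ pnormX mdegD exprD mulrCA.
Qed.

Lemma pnormM r p q : 0 <= r -> pnorm r (p * q) <= pnorm r p * pnorm r q.
Proof.
move=> r0; rewrite {1}(mpolyE p) mulr_suml (le_trans (pnorm_sum _ _ r0)) //.
rewrite {2}/pnorm mulr_suml; apply: ler_sum => l _.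
by rewrite -scalerAl pnormZ -mulrA ler_wpM2l // pnormXM.
Qed.

Lemma pnorm_exp r p j : 0 <= r -> pnorm r (p ^+ j) <= pnorm r p ^+ j.
Proof.
move=> r0; elim: j => [|j IH]; first by rewrite !expr0 pnorm1.
by rewrite !exprS (le_trans (pnormM _ _ r0)) // ler_wpM2l // pnorm_ge0.
Qed.

Lemma pnorm_prod r (I : Type) (s : seq I) (F : I -> {mpoly K[m]}) : 0 <= r ->
  pnorm r (\prod_(i <- s) F i) <= \prod_(i <- s) pnorm r (F i).
Proof.
move=> r0; elim: s => [|i s IH]; first by rewrite !big_nil pnorm1.
by rewrite !big_cons (le_trans (pnormM _ _ r0)) // ler_wpM2l // pnorm_ge0.
Qed.

Lemma ler_pnorm r s p : 0 <= s -> s <= r -> pnorm s p <= pnorm r p.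
Proof.
move=> s0 sr; apply: ler_sum => k _; rewrite ler_wpM2l //.
by rewrite lerXn2r // nnegrE // (le_trans s0).
Qed.

Lemma pnorm_scale r t p : 0 <= r -> 0 <= t -> t <= 1 -> p@_0 = 0 ->
  pnorm (t * r) p <= t * pnorm r p.
Proof.
move=> r0 t0 t1 p0; rewrite /pnorm mulr_sumr !big_seq.
apply: ler_sum => k kp; rewrite mulrCA ler_wpM2l // exprMn.
rewrite ler_wpM2r ?exprn_ge0 //.
have : mdeg k != 0%N.
  by rewrite mdeg_eq0; apply: contraTneq kp => ->; rewrite mcoeff_msupp p0 eqxx.
by case: (mdeg k) => // j _; rewrite exprS ler_piMr // exprn_ile1.
Qed.

Lemma convergentP a : convergent a <->
  exists r M : K, 0 < r /\ forall d, pnorm r (trunc d a) <= M.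
Proof.
by split=> -[r [M [r0 h]]]; exists r, M; split=> // d; have := h d;
  rewrite pnorm_trunc.
Qed.

Lemma convergent2 a b : convergent a -> convergent b ->
  exists r M : K, 0 < r /\
    forall d, pnorm r (trunc d a) <= M /\ pnorm r (trunc d b) <= M.
Proof.
move=> /convergentP[r [M [r0 ha]]] /convergentP[s [N [s0 hb]]].
pose t := r * s / (r + s).
have rs0 : 0 < r + s by rewrite addr_gt0.
have t0 : 0 < t by rewrite divr_gt0 // mulr_gt0.
have tr : t <= r by rewrite ler_pdivrMr // ler_pM2l // lerDr ltW.
have ts : t <= s by rewrite ler_pdivrMr // mulrC ler_pM2l // lerDl ltW.
have M0 : 0 <= M by apply: le_trans (ha 0%N); rewrite pnorm_ge0 // ltW.
have N0 : 0 <= N by apply: le_trans (hb 0%N); rewrite pnorm_ge0 // ltW.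
exists t, (M + N); split=> // d; split.
  by rewrite (le_trans (ler_pnorm _ (ltW t0) tr)) // (le_trans (ha d)) // lerDl.
by rewrite (le_trans (ler_pnorm _ (ltW t0) ts)) // (le_trans (hb d)) // lerDr.
Qed.

(* Agreement of two polynomials up to total degree < d. *)
Definition eqdeg d p q := forall k, (mdeg k < d)%N -> p@_k = q@_k.

Lemma eqdegM d p p' q q' : eqdeg d p p' -> eqdeg d q q' ->
  eqdeg d (p * q) (p' * q').
Proof.
move=> hp hq k kd; rewrite !mcoeffM; apply: eq_bigr => -[i j] /= _.
by rewrite hp ?hq // (leq_trans (bmdeg _)).
Qed.

Lemma eqdeg_trunc d d1 d2 a : (d <= d1)%N -> (d <= d2)%N ->
  eqdeg d (trunc d1 a) (trunc d2 a).
Proof.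
by move=> h1 h2 k kd; rewrite !mcoeff_trunc // (leq_trans kd).
Qed.

Lemma eqdeg_sum d (I : Type) (s : seq I) (F G : I -> {mpoly K[m]}) :
  (forall i, eqdeg d (F i) (G i)) ->
  eqdeg d (\sum_(i <- s) F i) (\sum_(i <- s) G i).
Proof. by move=> h k kd; rewrite !raddf_sum; apply: eq_bigr => i _; apply: h. Qed.

Lemma eqdeg_exp d p q j : eqdeg d p q -> eqdeg d (p ^+ j) (q ^+ j).
Proof. by move=> h; elim: j => // j IH; rewrite !exprS; apply: eqdegM. Qed.

Lemma eqdeg_prod d (I : Type) (s : seq I) (F G : I -> {mpoly K[m]}) :
  (forall i, eqdeg d (F i) (G i)) ->
  eqdeg d (\prod_(i <- s) F i) (\prod_(i <- s) G i).
Proof.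
move=> h; elim: s => [|i s IH]; first by rewrite !big_nil.
by rewrite !big_cons; apply: eqdegM.
Qed.

Lemma eqdeg0M d e p q : eqdeg d p 0 -> eqdeg e q 0 -> eqdeg (d + e) (p * q) 0.
Proof.
move=> hp hq k kd; rewrite mcoeffM mcoeff0 big1 // => -[i j] /= /eqP kE.
have [id|di] := ltnP (mdeg i) d; first by rewrite hp // mcoeff0 mul0r.
have [je|ej] := ltnP (mdeg j) e; first by rewrite hq // mcoeff0 mulr0.
by exfalso; move: kd; rewrite ltnNge (congr1 mdeg kE) mdegD leq_add.
Qed.

Lemma eqdeg0_exp p j : p@_0 = 0 -> eqdeg j (p ^+ j) 0.
Proof.
move=> p0; elim: j => // j IH; rewrite exprS -add1n; apply: eqdeg0M => //.
by move=> k; rewrite ltnS leqn0 mdeg_eq0 => /eqP ->; rewrite mcoeff0.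
Qed.

Lemma eqdeg0_prod (I : Type) (s : seq I) (F : I -> {mpoly K[m]}) (e : I -> nat) :
  (forall i, eqdeg (e i) (F i) 0) ->
  eqdeg (\sum_(i <- s) e i)%N (\prod_(i <- s) F i) 0.
Proof.
move=> h; elim: s => [|i s IH]; first by rewrite !big_nil.
by rewrite !big_cons; apply: eqdeg0M.
Qed.

End Convergence.

Section Germ.
Variables (K : numFieldType) (m : nat).

Record germ := Germ {
  coef :> 'X_{1..m} -> K;
  germ_convergent : convergent coef }.

Lemma germP (a b : germ) : coef a =1 coef b -> a = b.
Proof.
case: a b => [a ca] [b cb] /= /funext ab; subst b.
by rewrite (Prop_irrelevance ca cb).
Qed.

HB.instance Definition _ := gen_eqMixin germ.
HB.instance Definition _ := gen_choiceMixin germ.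

Implicit Types a b c : germ.

Lemma convergent_const (x : K) :
  convergent (fun k : 'X_{1..m} => if k == 0%MM then x else 0).
Proof.
apply/convergentP; exists 1, (pnorm 1 (x%:MP : {mpoly K[m]})).
split=> // d; rewrite pnorm_trunc.
apply: le_trans (sum_le_pnorm (x%:MP : {mpoly K[m]}) d ler01).
by apply: ler_sum => k _; rewrite mcoeffC; case: eqP; rewrite ?mulr1 ?mulr0.
Qed.
Definition germC x : germ := Germ (convergent_const x).

Lemma convergent_X (i : 'I_m) :
  convergent (fun k : 'X_{1..m} => if k == U_(i)%MM then 1 else 0 : K).
Proof.
apply/convergentP; exists 1, (pnorm 1 ('X_i : {mpoly K[m]})).
split=> // d; rewrite pnorm_trunc.
apply: le_trans (sum_le_pnorm ('X_i : {mpoly K[m]}) d ler01).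
by apply: ler_sum => k _; rewrite mcoeffX eq_sym; case: eqP.
Qed.
Definition germX i : germ := Germ (convergent_X i).

Lemma convergent_add a b : convergent (fun k => a k + b k).
Proof.
have [r [M [r0 h]]] := convergent2 (germ_convergent a) (germ_convergent b).
apply/convergentP; exists r, (M + M); split=> // d; have [h1 h2] := h d.
apply: le_trans (lerD h1 h2); apply: le_trans (pnormD _ _ (ltW r0)).
rewrite le_eqVlt; apply/orP; left; apply/eqP; congr pnorm.
by rewrite /trunc -big_split; apply: eq_bigr => k _; rewrite scalerDl.
Qed.
Definition germ_add a b : germ := Germ (convergent_add a b).

Lemma convergent_opp a : convergent (fun k => - a k).
Proof.
have [r [M [r0 h]]] := germ_convergent a.
exists r, M; split=> // d; apply: le_trans (h d).
by apply: ler_sum => k _; rewrite normrN.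
Qed.
Definition germ_opp a : germ := Germ (convergent_opp a).

Definition cauchy (a b : 'X_{1..m} -> K) (k : 'X_{1..m}) : K :=
  \sum_(h : 'X_{1..m < (mdeg k).+1, (mdeg k).+1} | k == (h.1 + h.2)%MM)
    a h.1 * b h.2.

Lemma cauchyE (a b : 'X_{1..m} -> K) d k : (mdeg k < d)%N ->
  cauchy a b k = (trunc d a * trunc d b)@_k.
Proof.
move=> kd; rewrite mcoeffM; apply: eq_bigr => -[i j] /= _.
by rewrite !mcoeff_trunc // (leq_trans (bmdeg _)).
Qed.

Lemma convergent_mul a b : convergent (cauchy a b).
Proof.
have [r [M [r0 h]]] := convergent2 (germ_convergent a) (germ_convergent b).
exists r, (M * M); split=> // d; have [h1 h2] := h d.
apply: (@le_trans _ _ (pnorm r (trunc d a * trunc d b))).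
  apply: le_trans (sum_le_pnorm _ d (ltW r0)).
  by apply: ler_sum => k _; rewrite (@cauchyE _ _ d) // bmdeg.
apply: le_trans (pnormM _ _ (ltW r0)) _.
by apply: ler_pM; rewrite // pnorm_ge0 // ltW.
Qed.
Definition germ_mul a b : germ := Germ (convergent_mul a b).

Fact germ_addA : associative germ_add.
Proof. by move=> a b c; apply: germP => k /=; rewrite addrA. Qed.
Fact germ_addC : commutative germ_add.
Proof. by move=> a b; apply: germP => k /=; rewrite addrC. Qed.
Fact germ_add0 : left_id (germC 0) germ_add.
Proof. by move=> a; apply: germP => k /=; rewrite if_same add0r. Qed.
Fact germ_addN : left_inverse (germC 0) germ_opp germ_add.
Proof. by move=> a; apply: germP => k /=; rewrite if_same addNr. Qed.

HB.instance Definition _ :=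
  GRing.isZmodule.Build germ germ_addA germ_addC germ_add0 germ_addN.

Lemma eqdeg_trunc_mul d a b :
  eqdeg d (trunc d (germ_mul a b)) (trunc d a * trunc d b).
Proof. by move=> k kd; rewrite mcoeff_trunc //= -cauchyE. Qed.

Fact germ_mulA : associative germ_mul.
Proof.
move=> a b c; apply: germP => k; set d := (mdeg k).+1.
have kd : (mdeg k < d)%N by [].
rewrite /= !(cauchyE _ _ kd).
rewrite (eqdegM (fun _ _ => erefl) (@eqdeg_trunc_mul d b c) kd).
by rewrite (eqdegM (@eqdeg_trunc_mul d a b) (fun _ _ => erefl) kd) mulrA.
Qed.

Fact germ_mulC : commutative germ_mul.
Proof.
move=> a b; apply: germP => k; have kd := ltnSn (mdeg k).
by rewrite /= !(cauchyE _ _ kd) mulrC.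
Qed.

Fact germ_mul1 : left_id (germC 1) germ_mul.
Proof.
move=> a; apply: germP => k; have kd := ltnSn (mdeg k).
rewrite /= (cauchyE _ _ kd).
have h : eqdeg (mdeg k).+1 (trunc (mdeg k).+1 (germC 1)) 1.
  by move=> j jd; rewrite mcoeff_trunc //= mcoeff1; case: eqP.
by rewrite (eqdegM h (fun _ _ => erefl) kd) mul1r mcoeff_trunc.
Qed.

Fact germ_mulDl : left_distributive germ_mul germ_add.
Proof.
move=> a b c; apply: germP => k /=; rewrite -big_split /=.
by apply: eq_bigr => h _; rewrite mulrDl.
Qed.

Fact germ_1neq0 : germC 1 != germC 0.
Proof.
apply/eqP => /(congr1 (fun a : germ => a 0%MM)) /=; rewrite eqxx.
by move/eqP; rewrite oner_eq0.
Qed.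

HB.instance Definition _ := GRing.Zmodule_isComNzRing.Build germ
  germ_mulA germ_mulC germ_mul1 germ_mulDl germ_1neq0.

(* Units are by definition the invertible elements; the inverse is obtained
   by choice. *)
Definition germ_unit : {pred germ} := fun a => `[< exists b, b * a = 1 >].
Definition germ_inv a : germ :=
  if pselect (exists b, b * a = 1) is left h then projT1 (cid h) else a.

Fact germ_mulV : {in germ_unit, left_inverse 1 germ_inv *%R}.
Proof.
move=> a /asboolP h; rewrite /germ_inv; case: pselect => // h'.
by case: (cid h').
Qed.
Fact germ_unitP a b : b * a = 1 -> germ_unit a.
Proof. by move=> h; apply/asboolP; exists b. Qed.
Fact germ_inv_out : {in [predC germ_unit], germ_inv =1 id}.
Proof. by move=> a /asboolP h; rewrite /germ_inv; case: pselect. Qed.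

HB.instance Definition _ := GRing.ComNzRing_hasMulInverse.Build germ
  germ_mulV germ_unitP germ_inv_out.

Lemma germ_least a : a != 0 ->
  exists k, a k != 0 /\ forall j, (j < k)%O -> a j = 0.
Proof.
move=> a0; have [k ak] : exists k, a k != 0.
  apply: contrapT => h; move/eqP: a0; apply; apply: germP => k /=.
  by rewrite if_same; apply/eqP/negPn/negP => ak; apply: h; exists k.
elim/(@ltmwf m): k ak => k IH ak.
have [[j [jk aj]]|h] := pselect (exists j, (j < k)%O /\ a j != 0).
  exact: (IH j).
exists k; split=> // j jk; apply/eqP/negPn/negP => aj.
by apply: h; exists j.
Qed.

Fact germ_integral a b : a * b = 0 -> (a == 0) || (b == 0).
Proof.
move=> ab; apply: contraTT isT => /norP[/germ_least[k [ak hk]]].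
move=> /germ_least[l [bl hl]]; exfalso.
have /(congr1 (fun c : germ => c (k + l)%MM)) := ab.
rewrite /= if_same /cauchy.
have kd : (mdeg k < (mdeg (k + l)%MM).+1)%N by rewrite ltnS mdegD leq_addr.
have ld : (mdeg l < (mdeg (k + l)%MM).+1)%N by rewrite ltnS mdegD leq_addl.
rewrite (bigD1 (BMultinom kd, BMultinom ld)) //= big1 ?addr0.
  by move/eqP; rewrite mulf_eq0 (negPf ak) (negPf bl).
move=> [i j] /= /andP[/eqP kl ne].
have [ik|ki|ik] := ltgtP (bmnm i) k; first by rewrite hk ?mul0r.
  have [jl|lj|jl] := ltgtP (bmnm j) l; first by rewrite hl ?mulr0.
  - by exfalso; have := ltm_add ki lj; rewrite -kl ltxx.
  - exfalso; have e := etrans (congr1 (mnm_add i) (esym jl)) (esym kl).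
    by have := ltmc_le_add ki (lexx l); rewrite e ltxx.
suff jl : bmnm j = l.
  case/negP: ne; rewrite xpair_eqE; apply/andP.
  by split; apply/eqP/val_inj.
apply/mnmP => x; move/mnmP/(_ x): kl; rewrite ik !mnmDE.
by move/addnI.
Qed.

HB.instance Definition _ := GRing.ComUnitRing_isIntegral.Build germ
  germ_integral.

Definition coprime_germs a b : Prop :=
  forall d : germ, (exists x, a = d * x) -> (exists y, b = d * y) ->
    d \is a GRing.unit.

End Germ.

(* Germs of holomorphic maps (K^k, 0) -> (K^m, 0). *)
Record germ_map (K : numFieldType) (k m : nat) := GermMap {
  component :> 'I_m -> germ K k;
  component0 : forall i, component i 0%MM = 0 }.

Section Composition.
Variables (K : numFieldType) (k m : nat).
Implicit Types (f : germ K m) (Phi : germ_map K k m).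

(* Taylor coefficients of f o Phi.  As Phi has no constant term, the
   coefficient at j only involves the terms of degree <= mdeg j of f and of
   the components of Phi. *)
Definition comp_coef f Phi (j : 'X_{1..k}) : K :=
  (trunc (mdeg j).+1 f \mPo [tuple trunc (mdeg j).+1 (Phi i) | i < m])@_j.

Lemma trunc0 d Phi i : (trunc d (Phi i))@_0 = 0.
Proof.
case: d => [|d]; first by rewrite mcoeff_trunc_ge.
by rewrite mcoeff_trunc ?mdeg0 ?component0.
Qed.

Lemma comp_mpoly_eqdeg d (p q : {mpoly K[m]}) (u v : m.-tuple {mpoly K[k]}) :
  eqdeg d p q -> (forall i, eqdeg d (tnth u i) (tnth v i)) ->
  (forall i, (tnth u i)@_0 = 0) -> eqdeg d (p \mPo u) (q \mPo v).
Proof.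
move=> pq uv u0; have h0 : eqdeg d ((p - q) \mPo u) 0.
  rewrite comp_mpolyE => j jd.
  rewrite raddf_sum mcoeff0 big_seq big1 //= => i ipq.
  rewrite mcoeffZ.
  have di : (d <= mdeg i)%N.
    rewrite leqNgt; apply: contraTN ipq => id.
    by rewrite mcoeff_msupp negbK mcoeffB pq // subrr.
  have := @eqdeg0_prod K k _ (index_enum 'I_m) (fun x => tnth u x ^+ i x)
    (fun x => i x) (fun x => eqdeg0_exp (u0 x)).
  rewrite -mdegE => /(_ j (leq_trans jd di)) ->.
  by rewrite mcoeff0 mulr0.
have -> : p = (p - q) + q by rewrite subrK.
rewrite comp_mpolyD => j jd; rewrite mcoeffD h0 // mcoeff0 add0r.
rewrite !comp_mpolyE.
apply: (@eqdeg_sum K k d _ (msupp q)) (jd) => i l ld.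
rewrite !mcoeffZ; congr (_ * _).
apply: (@eqdeg_prod K k d _ (index_enum 'I_m)) (ld) => x.
exact: eqdeg_exp.
Qed.

Lemma comp_coefE d f Phi j : (mdeg j < d)%N ->
  comp_coef f Phi j = (trunc d f \mPo [tuple trunc d (Phi i) | i < m])@_j.
Proof.
move=> jd; apply: (@comp_mpoly_eqdeg (mdeg j).+1) => //.
- exact: eqdeg_trunc.
- by move=> i; rewrite !tnth_mktuple; apply: eqdeg_trunc.
- by move=> i; rewrite tnth_mktuple trunc0.
Qed.

Lemma pnorm_comp r s (p : {mpoly K[m]}) (u : m.-tuple {mpoly K[k]}) :
  0 <= s -> 0 <= r -> (forall i, pnorm s (tnth u i) <= r) ->
  pnorm s (p \mPo u) <= pnorm r p.
Proof.
move=> s0 r0 h; rewrite comp_mpolyE (le_trans (pnorm_sum _ _ s0)) //.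
apply: ler_sum => i _; rewrite pnormZ ler_wpM2l //.
apply: le_trans (pnorm_prod _ _ s0) _.
rewrite mdegE -prodrXr; apply: ler_prod => x _.
rewrite pnorm_ge0 //= (le_trans (pnorm_exp _ _ s0)) //.
by rewrite lerXn2r // nnegrE // pnorm_ge0.
Qed.

Lemma germ_map_bound Phi : exists r M : K, [/\ 0 < r, 0 <= M &
  forall i d, pnorm r (trunc d (Phi i)) <= M].
Proof.
have h i : exists rM : K * K, 0 < rM.1 /\
    forall d, pnorm rM.1 (trunc d (Phi i)) <= rM.2.
  have /convergentP[r [M hM]] := germ_convergent (Phi i).
  by exists (r, M).
have [g hg] := choice h.
have g0 i : 0 < (g i).1 by have [] := hg i.
have M0 i : 0 <= (g i).2.
  have [_ /(_ 0%N)] := hg i; apply: le_trans.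
  by rewrite pnorm_ge0 // ltW.
pose t := 1 + \sum_i (g i).1^-1.
have t0 : 0 < t.
  rewrite ltr_pwDl // sumr_ge0 // => i _.
  by rewrite invr_ge0 ltW.
exists t^-1, (\sum_i (g i).2); split; first by rewrite invr_gt0.
  exact: sumr_ge0.
move=> i d; have [_ /(_ d) hd] := hg i.
have ti : t^-1 <= (g i).1.
  rewrite -[leRHS]invrK lef_pV2 ?posrE ?invr_gt0 //.
  rewrite /t (bigD1 i) //= addrCA lerDl addr_ge0 // sumr_ge0 // => x _.
  by rewrite invr_ge0 ltW.
apply: le_trans (ler_pnorm _ _ ti) _; first by rewrite invr_ge0 ltW.
by rewrite (le_trans hd) // (bigD1 i) //= lerDl sumr_ge0.
Qed.

Lemma convergent_comp f Phi : convergent (comp_coef f Phi).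
Proof.
have /convergentP[r [M [r0 hM]]] := germ_convergent f.
have [s [N [s0 N0 hN]]] := germ_map_bound Phi.
pose t := r / (r + N).
have rN : 0 < r + N by rewrite ltr_pwDl.
have t0 : 0 < t by rewrite divr_gt0.
have t1 : t <= 1 by rewrite ler_pdivrMr // mul1r lerDl.
have ts0 : 0 < t * s by rewrite mulr_gt0.
exists (t * s), M; split=> // d.
pose p := trunc d f \mPo [tuple trunc d (Phi i) | i < m].
apply: (@le_trans _ _ (pnorm (t * s) p)).
  apply: le_trans (sum_le_pnorm _ d (ltW ts0)).
  by apply: ler_sum => j _; rewrite (@comp_coefE d) // bmdeg.
apply: le_trans (hM d); apply: pnorm_comp; try exact: ltW.
move=> i; rewrite tnth_mktuple.
apply: le_trans (pnorm_scale (ltW s0) (ltW t0) t1 (trunc0 _ _ _)) _.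
apply: (@le_trans _ _ (t * N)); first by rewrite ler_wpM2l // ltW.
by rewrite mulrAC ler_pdivrMr // ler_pM2l // lerDr ltW.
Qed.

Definition germ_comp f Phi : germ K k := Germ (convergent_comp f Phi).

End Composition.

(* g is the pull-back f o Phi of the meromorphic germ f: writing f = p / q in
   lowest terms, q o Phi is not identically zero and
   g = (p o Phi) / (q o Phi). *)
Definition is_pullback (K : numFieldType) (k m : nat)
    (f : {fraction germ K m}) (Phi : germ_map K k m)
    (g : {fraction germ K k}) : Prop :=
  exists p q : germ K m,
    [/\ coprime_germs p q,
        q != 0 /\ f = FracField.tofrac p / FracField.tofrac q,
        germ_comp q Phi != 0 &
        g = FracField.tofrac (germ_comp p Phi) /
            FracField.tofrac (germ_comp q Phi)].

Definition biholomorphic (K : numFieldType) (m : nat) (Phi : germ_map K m m)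
    : Prop :=
  exists Psi : germ_map K m m, forall i,
    germ_comp (Phi i) Psi = germX K i /\ germ_comp (Psi i) Phi = germX K i.

(* Coordinates on K^(n+1) are (z_1, ..., z_n, w): w has index [ord_max] and
   the z's have indices [lift ord_max i], i < n. *)
Section Coordinates.
Variables (K : numFieldType) (n : nat).

Fact germX0 (m : nat) (i : 'I_m) : germX K i 0%MM = 0.
Proof. by rewrite /= eq_sym mnm1_eq0. Qed.

Definition coordw : germ K n.+1 := germX K ord_max.

Definition coordz : germ_map K n.+1 n :=
  GermMap (fun i : 'I_n => germX0 (lift ord_max i)).

(* w |-> (0, w) *)
Fact w_axis0 (i : 'I_n.+1) :
  (if i == ord_max then germX K (ord0 : 'I_1) else 0) 0%MM = 0.
Proof. by case: ifP => _; [apply: germX0 | rewrite /= if_same]. Qed.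
Definition w_axis : germ_map K 1 n.+1 := GermMap w_axis0.

Definition w_change (Phi : germ_map K n.+1 n.+1) : Prop :=
  biholomorphic Phi /\
  forall i : 'I_n, Phi (lift ord_max i) = germX K (lift ord_max i).

(* c_0(z) + c_1(z) w + ... + c_(d-1)(z) w^(d-1) + w^d *)
Definition w_monic (d : nat) (c : 'I_d -> germ K n) : germ K n.+1 :=
  \sum_(i < d) germ_comp (c i) coordz * coordw ^+ i + coordw ^+ d.

End Coordinates.

(* Main.v *)
From HB Require Import structures.
Require Import Defs.
From mathcomp Require Import all_boot all_order all_algebra.
From mathcomp Require Import boolp reals complex.
From mathcomp Require Import ssrcomplements mpoly ring.

Set Implicit Arguments.
Unset Strict Implicit.
Unset Printing Implicit Defensive.

Import Order.TTheory GRing.Theory Num.Theory.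
Local Open Scope ring_scope.

(** Let f = p / q in lowest terms, and let a and b be the orders at 0 of p(0, w)
    and q(0, w).  If a = b, replace f by f - c, where c is the value of f(0, w)
    at w = 0: since f(0, w) is not constant, the order of the numerator becomes
    finite and larger than b.  So assume that a and b are distinct
    ([separate_orders]); adding c back at the end keeps a monic numerator of
    degree a > b.

    The claim becomes that some change of coordinate w := w theta(z, w) makes
    p = A alpha and q = B alpha with the same unit alpha, where A and B are
    polynomials in w, monic of degrees a and b ([w_preparation]).  For fixed theta
    such factorizations exist with two different units, by Weierstrass
    preparation, and theta has to be chosen so that these coincide.  At z = 0, to
    first order, multiplying theta by 1 + tau multiplies the units by 1 + a tau
    and 1 + b tau, so their ratio can be adjusted precisely because a and b are
    distinct.  The factors theta, alpha, A and B are therefore obtained together,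
    as a fixed point.

    The variable w is given a small weight and the variables z a large one.
    On the polydisc where each variable has radius rho ^ (its weight), every term
    of p is then negligible compared to the one in w ^ a: the monomials w ^ j with
    j < a only occur multiplied by some z_i.  All operations used
    (sums, products, quotients and remainders by a power of w, substitution into
    a fixed convergent series) have a computable order of magnitude in rho,
    together with their increments ([bigO]).  The operator to be solved gains one
    order, hence contracts the small balls with a ratio proportional to rho.
    Because this holds for every small rho, two iterates agree up to a weight
    that tends to infinity: the iteration becomes stationary in each coefficient,
    and its limit satisfies the same bounds, hence converges ([fixpoint]).

    The same fixed point theorem gives the inverse of the change of coordinate
    ([shear_right_inverse]). *)

(** * Composition of germs through polynomial truncations *)

Section Agree.
Variables (K : numFieldType) (m : nat).
Implicit Types (a b : germ K m) (p q : {mpoly K[m]}).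

(** Identities between germs are checked modulo each degree [d], where germs may
    be replaced by polynomials. *)
Definition agree d a p := forall k, (mdeg k < d)%N -> a k = p@_k.

Lemma agree_trunc d a : agree d a (trunc d a).
Proof. by move=> k kd; rewrite mcoeff_trunc. Qed.

Lemma agree_eqdeg d a p : agree d a p -> eqdeg d (trunc d a) p.
Proof. by move=> h k kd; rewrite mcoeff_trunc // h. Qed.

Lemma agree_inj a b : (forall d, exists2 p, agree d a p & agree d b p) -> a = b.
Proof.
move=> h; apply: germP => k; have [p ha hb] := h (mdeg k).+1.
by rewrite ha // hb.
Qed.

Lemma agreeC d (c : K) : agree d (germC m c) c%:MP.
Proof. by move=> k _; rewrite mcoeffC /=; case: eqP; rewrite ?mulr1 ?mulr0. Qed.

Lemma agree0 d : agree d 0 0.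
Proof. by have := @agreeC d 0; rewrite mpolyC0. Qed.

Lemma agree1 d : agree d 1 1.
Proof. by have := @agreeC d 1; rewrite mpolyC1. Qed.

Lemma agreeX d i : agree d (germX K i) 'X_i.
Proof. by move=> k _; rewrite mcoeffX /= eq_sym; case: eqP. Qed.

Lemma agreeD d a b p q : agree d a p -> agree d b q -> agree d (a + b) (p + q).
Proof. by move=> ha hb k kd; rewrite mcoeffD -ha // -hb. Qed.

Lemma agreeM d a b p q : agree d a p -> agree d b q -> agree d (a * b) (p * q).
Proof.
move=> ha hb k kd; rewrite -(eqdegM (agree_eqdeg ha) (agree_eqdeg hb) kd).
exact: cauchyE.
Qed.

Lemma agree_exp d a p j : agree d a p -> agree d (a ^+ j) (p ^+ j).
Proof.
move=> ha; elim: j => [|j IH]; first by rewrite !expr0; apply: agree1.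
by rewrite !exprS; apply: agreeM.
Qed.

Lemma agree_sum d I (s : seq I) (F : I -> germ K m) (G : I -> {mpoly K[m]}) :
  (forall i, agree d (F i) (G i)) -> agree d (\sum_(i <- s) F i) (\sum_(i <- s) G i).
Proof.
move=> h; elim: s => [|i s IH]; first by rewrite !big_nil; apply: agree0.
by rewrite !big_cons; apply: agreeD.
Qed.

Lemma agree_prod d I (s : seq I) (F : I -> germ K m) (G : I -> {mpoly K[m]}) :
  (forall i, agree d (F i) (G i)) -> agree d (\prod_(i <- s) F i) (\prod_(i <- s) G i).
Proof.
move=> h; elim: s => [|i s IH]; first by rewrite !big_nil; apply: agree1.
by rewrite !big_cons; apply: agreeM.
Qed.

Lemma coef_germ_sum I (s : seq I) (F : I -> germ K m) k :
  (\sum_(i <- s) F i) k = \sum_(i <- s) F i k.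
Proof.
elim: s => [|i s IH]; first by rewrite !big_nil /= if_same.
by rewrite !big_cons -IH.
Qed.

Lemma coef_germCM (c : K) a k : (germC m c * a) k = c * a k.
Proof.
have kd := ltnSn (mdeg k).
by rewrite (agreeM (@agreeC _ c) (@agree_trunc _ a) kd) mcoeffCM mcoeff_trunc.
Qed.

Lemma coef_germC0 (c : K) : germC m c 0%MM = c.
Proof. by rewrite /= eqxx. Qed.

Lemma coef_germM0 a b : (a * b) 0%MM = a 0%MM * b 0%MM.
Proof.
have kd : (mdeg (0%MM : 'X_{1..m}) < 1)%N by rewrite mdeg0.
rewrite (agreeM (@agree_trunc _ a) (@agree_trunc _ b) kd).
by rewrite rmorphM /= !mcoeff_trunc.
Qed.

Lemma germC_is_zmod : zmod_morphism (@germC K m).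
Proof. by move=> c d; apply: germP => k /=; case: ifP; rewrite ?subr0. Qed.
Lemma germC_is_monoid : monoid_morphism (@germC K m).
Proof.
split=> // c d; apply: germP => k.
by rewrite coef_germCM /=; case: ifP; rewrite ?mulr0.
Qed.

HB.instance Definition _ :=
  GRing.isZmodMorphism.Build K (germ K m) (@germC K m) germC_is_zmod.
HB.instance Definition _ :=
  GRing.isMonoidMorphism.Build K (germ K m) (@germC K m) germC_is_monoid.

Definition germXm (k : 'X_{1..m}) : germ K m := \prod_i germX K i ^+ k i.

Lemma agree_Xm d k : agree d (germXm k) 'X_[k].
Proof.
rewrite mpolyXE_id; apply: agree_prod => i; apply: agree_exp; exact: agreeX.
Qed.

Lemma coef_Xm k j : germXm k j = (k == j)%:R.
Proof. by rewrite (@agree_Xm _ k j (ltnSn _)) mcoeffX. Qed.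

Lemma coef_XmM k a j : (germXm k * a) (k + j)%MM = a j.
Proof.
have kd := ltnSn (mdeg (k + j)).
rewrite (agreeM (@agree_Xm _ k) (@agree_trunc _ a) kd) mulrC mcoeffMX.
by rewrite mcoeff_trunc // ltnS mdegD leq_addl.
Qed.

Lemma germX_exp (i : 'I_m) d : germX K i ^+ d = germXm (U_(i) *+ d)%MM.
Proof.
have U j : (U_(i) *+ d)%MM j = ((j == i) * d)%N by rewrite mulmnE mnm1E eq_sym.
rewrite /germXm (bigD1 i) //= U eqxx mul1n big1 ?mulr1 // => j /negPf ji.
by rewrite U ji expr0.
Qed.

Lemma coef_Xn (i : 'I_m) d k : (germX K i ^+ d) k = (k == (U_(i) *+ d)%MM)%:R.
Proof. by rewrite germX_exp coef_Xm eq_sym. Qed.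

Lemma mnmUnD (i : 'I_m) d k : (U_(i) *+ d + k)%MM i = (d + k i)%N.
Proof. by rewrite mnmDE mulmnE mnm1E eqxx mul1n. Qed.

Lemma coef_XnM (i : 'I_m) d a k :
  (germX K i ^+ d * a) k = if (d <= k i)%N then a (k - U_(i) *+ d)%MM else 0.
Proof.
rewrite germX_exp; case: ifP => [dk|kd].
  have {1}<- : (U_(i) *+ d + (k - U_(i) *+ d))%MM = k.
    rewrite addmC submK //; apply/mnm_lepP => j.
    by rewrite mulmnE mnm1E; case: eqP => [<-|_]; rewrite ?mul1n ?mul0n.
  by rewrite coef_XmM.
rewrite /= /cauchy big1 // => -[j l] /eqP /= e.
rewrite coef_Xm; case: eqP => [wj|]; last by rewrite mul0r.
have := congr1 (fun k : 'X_{1..m} => k i) e.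
by rewrite /= -wj mnmUnD => ki; rewrite ki leq_addr in kd.
Qed.

End Agree.

Lemma germ_mapP (K : numFieldType) k m (Phi Psi : germ_map K k m) :
  (forall i, Phi i = Psi i) -> Phi = Psi.
Proof.
case: Phi Psi => [F hF] [G hG] /= /funext e; subst G.
by rewrite (Prop_irrelevance hF hG).
Qed.

Section CompAlgebra.
Variables (K : numFieldType) (k m : nat).
Implicit Types (f g : germ K m) (Phi : germ_map K k m).

Lemma agree_comp d f p Phi (u : m.-tuple {mpoly K[k]}) :
  agree d f p -> (forall i, agree d (Phi i) (tnth u i)) ->
  agree d (germ_comp f Phi) (p \mPo u).
Proof.
move=> hf hu j jd; rewrite -[LHS]/(comp_coef f Phi j) (comp_coefE _ _ jd).
apply: comp_mpoly_eqdeg (jd).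
- exact: agree_eqdeg.
- by move=> i; rewrite tnth_mktuple; apply: agree_eqdeg.
- by move=> i; rewrite tnth_mktuple Defs.trunc0.
Qed.

Definition truncs d Phi := [tuple trunc d (Phi i) | i < m].

Lemma agree_truncs d Phi i : agree d (Phi i) (tnth (truncs d Phi) i).
Proof. by rewrite tnth_mktuple; apply: agree_trunc. Qed.

Lemma germ_compD f g Phi : germ_comp (f + g) Phi = germ_comp f Phi + germ_comp g Phi.
Proof.
apply: agree_inj => d; exists ((trunc d f + trunc d g) \mPo truncs d Phi).
  by apply: agree_comp (@agree_truncs d Phi); apply: agreeD; apply: agree_trunc.
by rewrite comp_mpolyD; apply: agreeD;
  apply: agree_comp (@agree_truncs d Phi); apply: agree_trunc.
Qed.

Lemma germ_compM f g Phi : germ_comp (f * g) Phi = germ_comp f Phi * germ_comp g Phi.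
Proof.
apply: agree_inj => d; exists ((trunc d f * trunc d g) \mPo truncs d Phi).
  by apply: agree_comp (@agree_truncs d Phi); apply: agreeM; apply: agree_trunc.
by rewrite rmorphM; apply: agreeM;
  apply: agree_comp (@agree_truncs d Phi); apply: agree_trunc.
Qed.

Lemma germ_compC c Phi : germ_comp (germC m c) Phi = germC k c.
Proof.
apply: agree_inj => d; exists (c%:MP \mPo truncs d Phi); last first.
  by rewrite comp_mpolyC; apply: agreeC.
by apply: agree_comp (@agree_truncs d Phi); apply: agreeC.
Qed.

(** [germ_comp] with its arguments exchanged, so that it can carry the structure
    of a ring morphism. *)
Definition pull Phi f := germ_comp f Phi.

Lemma pull_is_zmod Phi : zmod_morphism (pull Phi).
Proof.
move=> f g; apply: (addIr (germ_comp g Phi)).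
by rewrite subrK -germ_compD subrK.
Qed.
Lemma pull_is_monoid Phi : monoid_morphism (pull Phi).
Proof. by split; [apply: germ_compC | move=> f g; apply: germ_compM]. Qed.

HB.instance Definition _ Phi :=
  GRing.isZmodMorphism.Build (germ K m) (germ K k) (pull Phi) (pull_is_zmod Phi).
HB.instance Definition _ Phi :=
  GRing.isMonoidMorphism.Build (germ K m) (germ K k) (pull Phi) (pull_is_monoid Phi).

Lemma germ_compX i Phi : germ_comp (germX K i) Phi = Phi i.
Proof.
apply: agree_inj => d; exists (tnth (truncs d Phi) i); last exact: agree_truncs.
have -> : tnth (truncs d Phi) i = 'X_i \mPo truncs d Phi.
  by rewrite comp_mpolyXU -tnth_nth.
by apply: agree_comp (@agree_truncs d Phi); apply: agreeX.
Qed.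

Definition comp_upto d f Phi : germ K k :=
  \sum_(l : 'X_{1..m < d}) germC k (f l) * \prod_i Phi i ^+ (l : 'X_{1..m}) i.

(** The components of [Phi] vanish at the origin, so the monomials of degree at
    least [d] of [f] only contribute to degrees at least [d]. *)
Lemma germ_comp_sum d f Phi j : (mdeg j < d)%N ->
  germ_comp f Phi j = comp_upto d f Phi j.
Proof.
move=> jd; have := agree_comp (@agree_trunc _ _ d f) (@agree_truncs d Phi) jd.
move=> ->; suff h : agree d (comp_upto d f Phi) (trunc d f \mPo truncs d Phi).
  by rewrite h.
rewrite /trunc raddf_sum /=.
apply: agree_sum => l; rewrite comp_mpolyZ comp_mpolyX -mul_mpolyC.
apply: agreeM; first exact: agreeC.
by apply: agree_prod => i; apply: agree_exp; apply: agree_truncs.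
Qed.

Lemma germ_comp0 f Phi : germ_comp f Phi 0%MM = f 0%MM.
Proof.
have d1 : (mdeg (0%MM : 'X_{1..k}) < 1)%N by rewrite mdeg0.
rewrite (germ_comp_sum _ _ d1) /comp_upto coef_germ_sum.
have e1 : (mdeg (0%MM : 'X_{1..m}) < 1)%N by rewrite mdeg0.
rewrite (bigD1 (BMultinom e1)) // -[LHS]/(_ + _) [X in _ + X]big1; last first.
  move=> l /negP h; case: h; apply/eqP; apply: val_inj; apply/eqP => /=.
  by rewrite -mdeg_eq0 -leqn0 -ltnS bmdeg.
by rewrite addr0 coef_germCM big1 ?coef_germC0 ?mulr1 // => i _; rewrite mnm0E expr0.
Qed.

End CompAlgebra.

Section CompAssoc.
Variables (K : numFieldType) (l k m : nat).

Lemma germ_map_comp0 (Phi : germ_map K k m) (Psi : germ_map K l k) i :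
  germ_comp (Phi i) Psi 0%MM = 0.
Proof. by rewrite germ_comp0 component0. Qed.
Definition germ_map_comp Phi Psi : germ_map K l m := GermMap (@germ_map_comp0 Phi Psi).

Lemma germ_compA (f : germ K m) (Phi : germ_map K k m) (Psi : germ_map K l k) :
  germ_comp (germ_comp f Phi) Psi = germ_comp f (germ_map_comp Phi Psi).
Proof.
apply: germP => j; have jd := ltnSn (mdeg j); move: jd; set d := (mdeg j).+1 => jd.
rewrite (germ_comp_sum f (germ_map_comp Phi Psi) jd).
have h : agree d (germ_comp f Phi) (trunc d (comp_upto d f Phi)).
  by move=> i id; rewrite (germ_comp_sum _ _ id) mcoeff_trunc.
rewrite (agree_comp h (@agree_truncs _ _ _ d Psi) jd).
rewrite -(agree_comp (@agree_trunc _ _ d _) (@agree_truncs _ _ _ d Psi) jd).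
rewrite -/(pull Psi _) rmorph_sum; congr (coef _ j).
apply: eq_bigr => i _; rewrite rmorphM /= {1}/pull germ_compC rmorph_prod; congr (_ * _).
by apply: eq_bigr => x _; rewrite rmorphXn.
Qed.

End CompAssoc.

Lemma germ_comp_id (K : numFieldType) m (f : germ K m) (Phi : germ_map K m m) :
  (forall i, Phi i = germX K i) -> germ_comp f Phi = f.
Proof.
move=> h; apply: germP => j; have jd := ltnSn (mdeg j).
rewrite (germ_comp_sum _ _ jd) /comp_upto coef_germ_sum.
rewrite (bigD1 (BMultinom jd)) // -[LHS]/(_ + _) [X in _ + X]big1 ?addr0.
  under eq_bigr do rewrite h.
  by rewrite coef_germCM coef_Xm eqxx mulr1.
move=> i ij; under eq_bigr do rewrite h.
rewrite coef_germCM coef_Xm; case: eqP => [e|]; last by rewrite mulr0.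
by case/negP: ij; apply/eqP; apply: val_inj.
Qed.

(** * Weighted norms on polydiscs of vanishing radius *)

Section Small.
Variable K : numFieldType.
Implicit Types P Q : K -> Prop.

(** The filter of small positive radii.  The order of [K] is partial, which is
    why two radii are compared through [r * s / (r + s)] and not their
    minimum. *)
Definition small P := exists2 r : K, 0 < r & forall rho, 0 < rho -> rho <= r -> P rho.

Lemma small_and P Q : small P -> small Q -> small (fun rho => P rho /\ Q rho).
Proof.
move=> [r r0 hr] [s s0 hs].
have rs0 : 0 < r + s by rewrite addr_gt0.
exists (r * s / (r + s)); first by rewrite divr_gt0 // mulr_gt0.
move=> rho rho0 le; split; [apply: hr | apply: hs] => //; apply: le_trans le _.
  by rewrite ler_pdivrMr // ler_pM2l // lerDr ltW.
by rewrite ler_pdivrMr // mulrC ler_pM2l // lerDl ltW.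
Qed.

Lemma small_mono P Q :
  (forall rho, 0 < rho -> P rho -> Q rho) -> small P -> small Q.
Proof. by move=> PQ [r r0 h]; exists r => // rho ? ?; apply/PQ/h. Qed.

Lemma small_le (C c : K) : 0 <= C -> 0 < c -> small (fun rho => C * rho <= c).
Proof.
move=> C0 c0; have C1 : 0 < C + 1 by rewrite ltr_wpDl.
exists (c / (C + 1)); first by rewrite divr_gt0.
move=> rho rho0; rewrite ler_pdivlMr // mulrDr mulr1 mulrC; apply: le_trans.
by rewrite lerDl ltW.
Qed.

Lemma small_le1 : small (fun rho => rho <= 1).
Proof. by exists 1. Qed.

Lemma small_all (I : finType) (P : I -> K -> Prop) :
  (forall i, small (P i)) -> small (fun rho => forall i, P i rho).
Proof.
move=> h; suff : small (fun rho => forall i, i \in enum I -> P i rho).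
  by apply: small_mono => rho _ hP i; apply: hP; rewrite mem_enum.
elim: (enum I) => [|j s IH]; first by exists 1.
apply: small_mono (small_and (h j) IH) => rho _ [hj hs] i.
by rewrite inE => /orP[/eqP-> // | /hs].
Qed.

Lemma small_ex P : small P -> exists2 rho, 0 < rho & P rho.
Proof. by move=> [r r0 h]; exists r => //; apply: h. Qed.

(** Let [rho] tend to 0.  This is how estimates valid on every small polydisc
    force coefficients of low weight to vanish. *)
Lemma small_eq0 (x C : K) (a b : nat) : (a < b)%N ->
  small (fun rho => `|x| * rho ^+ a <= C * rho ^+ b) -> x = 0.
Proof.
move=> ab h; apply/eqP/negPn/negP => x0.
have x1 : 0 < `|x| by rewrite normr_gt0.
have C0 : 0 <= C.
  have [rho rho0 hr] := small_ex h.
  have := le_trans (mulr_ge0 (normr_ge0 x) (exprn_ge0 a (ltW rho0))) hr.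
  by rewrite pmulr_lge0 // exprn_gt0.
have [rho rho0 [[h1 h2] h3]] := small_ex (small_and (small_and h small_le1)
  (small_le C0 (divr_gt0 x1 (ltr0n _ 2)))).
suff lt : C * rho ^+ b < `|x| * rho ^+ a by rewrite (lt_geF lt) in h1.
have -> : b = (a + (b - a).-1.+1)%N by rewrite prednK ?subn_gt0 // subnKC // ltnW.
rewrite exprD mulrCA mulrC ltr_pM2r ?exprn_gt0 //.
apply: (@le_lt_trans _ _ (C * rho)).
  have r0 := ltW rho0.
  by rewrite ler_wpM2l // exprS ler_piMr // exprn_ile1.
by apply: le_lt_trans h3 _; rewrite ltr_pdivrMr // mulr_natr mulr2n ltrDl.
Qed.

End Small.

Section WeightedNorm.
Variables (K : numFieldType) (m : nat) (om : 'I_m -> nat).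
Implicit Types (a b : germ K m) (rho M : K).

Definition wt (k : 'X_{1..m}) : nat := (\sum_i k i * om i)%N.

Lemma wtD k l : wt (k + l)%MM = (wt k + wt l)%N.
Proof. by rewrite /wt -big_split; apply: eq_bigr => i _; rewrite mnmDE mulnDl. Qed.

Lemma wt0 : wt 0%MM = 0%N.
Proof. by rewrite /wt big1 // => i _; rewrite mnm0E. Qed.

Lemma wtU i : wt U_(i)%MM = om i.
Proof.
rewrite /wt (bigD1 i) //= mnm1E eqxx mul1n big1 ?addn0 // => j /negPf ji.
by rewrite mnm1E eq_sym ji.
Qed.

Lemma wtUn i j : wt (U_(i) *+ j)%MM = (om i * j)%N.
Proof.
elim: j => [|j IH]; first by rewrite mulm0n wt0 muln0.
by rewrite mulmS wtD wtU IH mulnS.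
Qed.

(** The l1 norm of the series on the polydisc of radii [rho ^+ om i] is at most
    [M].  Balls of this norm are stable under coefficientwise limits. *)
Definition bnd rho M (a : 'X_{1..m} -> K) :=
  forall d, \sum_(k : 'X_{1..m < d}) `|a k| * rho ^+ wt k <= M.

Lemma bnd_le rho M M' a : M <= M' -> bnd rho M a -> bnd rho M' a.
Proof. by move=> le h d; apply: le_trans le. Qed.

Lemma bnd_ge0 rho M a : bnd rho M a -> 0 <= M.
Proof. by move=> /(_ 0%N); apply: le_trans; rewrite big1 // => -[]. Qed.

(** Only the terms of degree less than [d] enter the d-th partial sum, so [b] may
    depend on [d]: this is how bounds pass to compositions and to limits. *)
Lemma bnd_lim rho M (a : 'X_{1..m} -> K) :
  (forall d, exists2 b : germ K m, bnd rho M b & forall k, (mdeg k < d)%N -> a k = b k) ->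
  bnd rho M a.
Proof.
move=> h d; have [b hb ab] := h d; apply: le_trans (hb d).
by apply: ler_sum => k _; rewrite (ab _ (bmdeg k)).
Qed.

Lemma bnd_seq rho M (a : 'X_{1..m} -> K) (s : seq 'X_{1..m}) :
  0 <= rho -> bnd rho M a -> uniq s -> \sum_(k <- s) `|a k| * rho ^+ wt k <= M.
Proof.
move=> r0 h us; pose d := (\max_(k <- s) mdeg k).+1.
apply: le_trans (h d).
rewrite (big_mksub 'X_{1..m < d}) //=; last first.
  by move=> k ks; rewrite /d ltnS; apply: leq_bigmax_seq.
rewrite [leRHS](bigID (fun k : 'X_{1..m < d} => val k \in s)) /= lerDl.
by apply: sumr_ge0 => k _; rewrite mulr_ge0 ?exprn_ge0.
Qed.

Lemma bnd_coef rho M (a : 'X_{1..m} -> K) k :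
  0 <= rho -> bnd rho M a -> `|a k| * rho ^+ wt k <= M.
Proof. by move=> r0 h; have := @bnd_seq _ _ _ [:: k] r0 h isT; rewrite big_seq1. Qed.

Lemma bnd_single rho (a : 'X_{1..m} -> K) k0 : 0 <= rho ->
  (forall k, k != k0 -> a k = 0) -> bnd rho (`|a k0| * rho ^+ wt k0) a.
Proof.
move=> r0 h d; have [kd|dk] := ltnP (mdeg k0) d.
  rewrite (bigD1 (BMultinom kd)) //= big1 ?addr0 // => k kk.
  by rewrite h ?normr0 ?mul0r.
rewrite big1 ?mulr_ge0 ?exprn_ge0 // => k _.
rewrite h ?normr0 ?mul0r //; apply: contraTneq dk => <-.
by rewrite -ltnNge bmdeg.
Qed.

Lemma bndC rho (c : K) : 0 <= rho -> bnd rho `|c| (germC m c).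
Proof.
move=> r0; have := @bnd_single rho (germC m c) 0%MM r0.
by rewrite coef_germC0 wt0 mulr1; apply => k /negPf /= ->.
Qed.

Lemma bndX rho i : 0 <= rho -> bnd rho (rho ^+ om i) (germX K i).
Proof.
move=> r0; have := @bnd_single rho (germX K i) U_(i)%MM r0.
by rewrite /= eqxx normr1 mul1r wtU; apply => k /negPf /= ->.
Qed.

Lemma bnd0 rho M : 0 <= M -> bnd rho M (0 : germ K m).
Proof.
by move=> M0 d; rewrite big1 // => k _; rewrite /= if_same normr0 mul0r.
Qed.

Lemma bndD rho M N a b : 0 <= rho ->
  bnd rho M a -> bnd rho N b -> bnd rho (M + N) (a + b).
Proof.
move=> r0 ha hb d; apply: le_trans (lerD (ha d) (hb d)).
rewrite -big_split; apply: ler_sum => k _ /=.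
by rewrite -mulrDl ler_wpM2r ?exprn_ge0 ?ler_normD.
Qed.

Lemma bndN rho M a : bnd rho M a -> bnd rho M (- a).
Proof. by move=> h d; under eq_bigr do rewrite normrN; apply: h. Qed.

Lemma bndB rho M N a b : 0 <= rho ->
  bnd rho M a -> bnd rho N b -> bnd rho (M + N) (a - b).
Proof. by move=> r0 ha /bndN; apply: bndD. Qed.

(** Rescaling the variables turns the weighted norm into the norm of radius 1,
    which is submultiplicative. *)
Lemma bndM rho M N a b : 0 <= rho ->
  bnd rho M a -> bnd rho N b -> bnd rho (M * N) (a * b).
Proof.
move=> r0 ha hb d.
pose sc (c : 'X_{1..m} -> K) k := c k * rho ^+ wt k.
have nsc c k : `|sc c k| = `|c k| * rho ^+ wt k.
  by rewrite normrM (ger0_norm (exprn_ge0 _ r0)).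
have n1 c : pnorm 1 (trunc d (sc c)) = \sum_(k : 'X_{1..m < d}) `|c k| * rho ^+ wt k.
  by rewrite pnorm_trunc; apply: eq_bigr => k _; rewrite expr1n mulr1 nsc.
apply: le_trans (_ : pnorm 1 (trunc d (sc a) * trunc d (sc b)) <= _).
  apply: le_trans (sum_le_pnorm _ d ler01).
  apply: ler_sum => k _; rewrite expr1n mulr1 -(cauchyE _ _ (bmdeg k)).
  suff -> : cauchy (sc a) (sc b) k = (a * b) k * rho ^+ wt k.
    by rewrite normrM (ger0_norm (exprn_ge0 _ r0)).
  rewrite /= /cauchy mulr_suml; apply: eq_bigr => h /eqP kh.
  by rewrite (congr1 wt kh) wtD exprD mulrACA.
apply: le_trans (pnormM _ _ ler01) _; rewrite !n1.
by apply: ler_pM => //; apply: sumr_ge0 => k _; rewrite mulr_ge0 ?exprn_ge0.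
Qed.

Lemma wt_le_mdeg k : (wt k <= (\sum_i om i) * mdeg k)%N.
Proof.
rewrite mdegE big_distrr; apply: leq_sum => i _; rewrite mulnC.
by rewrite leq_mul2r (bigD1 i) //= leq_addr orbT.
Qed.

Lemma mdeg_le_wt k : (forall i, 0 < om i)%N -> (mdeg k <= wt k)%N.
Proof. by move=> h; rewrite mdegE; apply: leq_sum => i _; rewrite leq_pmulr. Qed.

Lemma bnd_convergent rho M (a : 'X_{1..m} -> K) :
  0 < rho -> rho <= 1 -> bnd rho M a -> convergent a.
Proof.
move=> r0 r1 h; exists (rho ^+ (\sum_i om i)), M; split=> [|d].
  exact: exprn_gt0.
apply: le_trans (h d); apply: ler_sum => k _; apply: ler_wpM2l => //.
by rewrite -exprM; apply: ler_wiXn2l => //; [apply: ltW | apply: wt_le_mdeg].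
Qed.

(** Terms of weight at least [N] are of size [rho ^+ N] on a small polydisc.  The
    factor [B ^+ mdeg k], absorbed by shrinking the radius, leaves room for
    replacing each variable by something [B] times larger. *)
Lemma germ_small_bnd (f : germ K m) (N : nat) (B : K) :
  (forall i, 0 < om i)%N -> 1 <= B -> (forall k, (wt k < N)%N -> f k = 0) ->
  exists2 C, 0 <= C & small (fun rho => forall d,
    \sum_(k : 'X_{1..m < d}) `|f k| * (B ^+ mdeg k * rho ^+ wt k) <= C * rho ^+ N).
Proof.
move=> om0 B1 fN; have [r [M [r0 h]]] := germ_convergent f.
have B0 : 0 < B by apply: lt_le_trans B1.
have M0 : 0 <= M.
  apply: le_trans (h 0%N).
  by apply: sumr_ge0 => k _; rewrite mulr_ge0 // exprn_ge0 // ltW.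
have [r1 r10 [Br1 r1le]] := small_ex (small_and (small_le (ltW B0) r0) (small_le1 K)).
exists (M / r1 ^+ N); first by rewrite divr_ge0 // exprn_ge0 // ltW.
exists r1 => // rho rho0 le d.
have [rho_ge0 r1_ge0 B_ge0] := And3 (ltW rho0) (ltW r10) (ltW B0).
have -> : M / r1 ^+ N * rho ^+ N = rho ^+ N / r1 ^+ N * M by ring.
apply: le_trans (ler_wpM2l _ (h d)); last by rewrite divr_ge0 ?exprn_ge0.
rewrite mulr_sumr; apply: ler_sum => k _.
have [kN|Nk] := ltnP (wt k) N; first by rewrite fN // normr0 !mul0r mulr0.
rewrite [leRHS]mulrCA ler_wpM2l //; set g := mdeg k.
rewrite [leRHS]mulrAC ler_pdivlMr ?exprn_gt0 //.
have -> : wt k = (N + (wt k - N))%N by rewrite subnKC.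
rewrite exprD [B ^+ _ * _]mulrCA -!mulrA ler_wpM2l ?exprn_ge0 //.
apply: (@le_trans _ _ (B ^+ g * r1 ^+ g)); last first.
  by rewrite -exprMn lerXn2r // nnegrE ?mulr_ge0 // ltW.
apply: ler_wpM2l; first by rewrite exprn_ge0.
apply: (@le_trans _ _ (r1 ^+ (wt k - N) * r1 ^+ N)).
  by apply: ler_wpM2r; rewrite ?exprn_ge0 // lerXn2r // nnegrE.
by rewrite -exprD subnK // ler_wiXn2l // mdeg_le_wt.
Qed.

End WeightedNorm.

(** * Division by a power of a variable *)

Section Weierstrass.
Variables (K : numFieldType) (m : nat) (w : 'I_m) (d : nat).
Implicit Types h : germ K m.

Let wd : 'X_{1..m} := (U_(w) *+ d)%MM.

Lemma wdE i : wd i = ((i == w) * d)%N.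
Proof. by rewrite /wd mulmnE mnm1E eq_sym. Qed.

Definition rem_coef h (k : 'X_{1..m}) := if (k w < d)%N then h k else 0.
Definition quo_coef h (k : 'X_{1..m}) := h (k + wd)%MM.

Lemma bnd_rem_coef om rho M h : 0 <= rho -> bnd om rho M h -> bnd om rho M (rem_coef h).
Proof.
move=> r0 hM l; apply: le_trans (hM l); apply: ler_sum => k _.
by rewrite ler_wpM2r ?exprn_ge0 // /rem_coef; case: ifP; rewrite ?normr0.
Qed.

(** Dividing by the d-th power of a variable costs exactly the norm of that
    power; the remainder costs nothing. *)
Lemma bnd_quo_coef om rho M h : 0 < rho -> bnd om rho M h ->
  bnd om rho (M / rho ^+ (om w * d)) (quo_coef h).
Proof.
move=> r0 hM l; rewrite ler_pdivlMr ?exprn_gt0 // mulr_suml.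
have inj : injective (fun k : 'X_{1..m < l} => (bmnm k + wd)%MM).
  by move=> k k' /addIm /val_inj.
have us : uniq [seq (bmnm k + wd)%MM | k : 'X_{1..m < l}].
  by rewrite map_inj_uniq // enum_uniq.
apply: le_trans (bnd_seq (ltW r0) hM us).
rewrite big_image /=; apply: ler_sum => k _.
by rewrite -mulrA -exprD -(wtUn om) -wtD.
Qed.

Lemma germ_bnd1 h : exists rho M : K, [/\ 0 < rho, rho <= 1 & bnd (fun=> 1%N) rho M h].
Proof.
have om1 i : (0 < (fun _ : 'I_m => 1) i)%N by [].
have [|C C0 /small_and/(_ (small_le1 K)) /small_ex[r r0 [hr r1]]] :=
  @germ_small_bnd K m (fun=> 1%N) h 0 1 om1 (lexx _); first by [].
exists r, (C * r ^+ 0); split=> // d'.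
by have := hr d'; under eq_bigr do rewrite expr1n mul1r.
Qed.

Lemma convergent_rem h : convergent (rem_coef h).
Proof.
have [r [M [r0 r1 hM]]] := germ_bnd1 h.
exact: bnd_convergent r0 r1 (bnd_rem_coef (ltW r0) hM).
Qed.
Definition wrem h := Germ (convergent_rem h).

Lemma convergent_quo h : convergent (quo_coef h).
Proof.
have [r [M [r0 r1 hM]]] := germ_bnd1 h.
exact: bnd_convergent r0 r1 (bnd_quo_coef r0 hM).
Qed.
Definition wquo h := Germ (convergent_quo h).

Lemma remB h h' : wrem (h - h') = wrem h - wrem h'.
Proof. by apply: germP => k /=; rewrite /rem_coef /=; case: ifP; rewrite ?subr0. Qed.

Lemma quoB h h' : wquo (h - h') = wquo h - wquo h'.
Proof. exact: germP. Qed.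

Lemma quo_rem h : germX K w ^+ d * wquo h + wrem h = h.
Proof.
apply: germP => k; rewrite -[LHS]/((germX K w ^+ d * wquo h) k + rem_coef h k).
rewrite coef_XnM /rem_coef ltnNge; case: (boolP (d <= k w)%N) => dk /=.
  rewrite addr0 /quo_coef submK //; apply/mnm_lepP => i; rewrite wdE.
  by case: eqP => [->|_]; rewrite ?mul1n ?mul0n.
by rewrite add0r.
Qed.

End Weierstrass.

(** * Operators of controlled size and their fixed points *)

Section Operators.
Variables (K : numFieldType) (m : nat) (om : 'I_m -> nat).
Hypothesis om_gt0 : forall i, (0 < om i)%N.
Variables (I : finType) (eps : I -> nat).
Notation X := (I -> germ K m).
Implicit Types (rho B C M : K) (x y : X) (F G : X -> germ K m).

(** The unknown is a family [x] of germs; its component [i] is sought of size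
    [rho ^+ eps i] on the polydisc of parameter [rho], for all small [rho] at
    once. *)
Definition ball rho x := forall i, bnd om rho (rho ^+ eps i) (x i).
Definition near rho M x y := forall i, bnd om rho (M * rho ^+ eps i) (x i - y i).

(** The same constant bounds the size and the Lipschitz ratio: in this form the
    constants of sums and products follow from those of their arguments, as norms
    do. *)
Definition ctrl rho B F :=
  (forall x, ball rho x -> bnd om rho B (F x)) /\
  (forall x y M, ball rho x -> ball rho y -> 0 <= M -> near rho M x y ->
     bnd om rho (B * M) (F x - F y)).

Lemma ctrl_ge0 rho B F : 0 <= rho -> ctrl rho B F -> 0 <= B.
Proof.
move=> r0 [h _]; apply: (@bnd_ge0 _ _ om rho B (F (fun=> 0))); apply: h => i.
by apply: bnd0; rewrite exprn_ge0.
Qed.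

Lemma ctrl_le rho B B' F : 0 <= rho -> B <= B' -> ctrl rho B F -> ctrl rho B' F.
Proof.
move=> r0 le h; have B0 := ctrl_ge0 r0 h; case: h => h1 h2; split=> [x bx|x y M bx by_ M0 hn].
  exact: bnd_le le (h1 x bx).
by apply: bnd_le (h2 x y M bx by_ M0 hn); apply: ler_wpM2r.
Qed.

Lemma ctrl_const rho B (c : germ K m) :
  0 <= rho -> bnd om rho B c -> ctrl rho B (fun=> c).
Proof.
move=> r0 h; split=> // x y M _ _ M0 _; rewrite subrr; apply: bnd0.
by rewrite mulr_ge0 ?(bnd_ge0 h).
Qed.

Lemma ctrlD rho B B' F G : 0 <= rho -> ctrl rho B F -> ctrl rho B' G ->
  ctrl rho (B + B') (fun x => F x + G x).
Proof.
move=> r0 [f1 f2] [g1 g2]; split=> [x bx|x y M bx by_ M0 hn].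
  by apply: bndD; [|apply: f1|apply: g1].
rewrite mulrDl opprD addrACA.
by apply: bndD => //; [apply: f2|apply: g2].
Qed.

Lemma ctrlN rho B F : ctrl rho B F -> ctrl rho B (fun x => - F x).
Proof.
move=> [f1 f2]; split=> [x bx|x y M bx by_ M0 hn]; first by apply/bndN/f1.
by rewrite -opprD; apply/bndN/f2.
Qed.

Lemma ctrl_sum rho J (s : seq J) (B : J -> K) (F : J -> X -> germ K m) :
  0 <= rho -> (forall j, ctrl rho (B j) (F j)) ->
  ctrl rho (\sum_(j <- s) B j) (fun x => \sum_(j <- s) F j x).
Proof.
move=> r0 h; elim: s => [|j s IH].
  under [X in ctrl _ _ X]eq_fun do rewrite big_nil; rewrite big_nil.
  by apply: ctrl_const => //; apply: bnd0.
under [X in ctrl _ _ X]eq_fun do rewrite big_cons; rewrite big_cons.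
exact: ctrlD.
Qed.

(** The factor 2 comes from the two terms of the increment of a product. *)
Lemma ctrlM rho B B' F G : 0 <= rho -> ctrl rho B F -> ctrl rho B' G ->
  ctrl rho (2 * (B * B')) (fun x => F x * G x).
Proof.
move=> r0 hF hG; have B0 := ctrl_ge0 r0 hF; have B'0 := ctrl_ge0 r0 hG.
case: hF hG => [f1 f2] [g1 g2]; split=> [x bx|x y M bx by_ M0 hn].
  apply: (@bnd_le _ _ _ _ (B * B')); last by apply: bndM; [|apply: f1|apply: g1].
  by rewrite mulr_natl mulr2n lerDl mulr_ge0.
have -> : F x * G x - F y * G y = (F x - F y) * G x + F y * (G x - G y) by ring.
have -> : 2 * (B * B') * M = (B * M) * B' + B * (B' * M) by ring.
apply: bndD => //; apply: bndM => //.
- exact: f2. - exact: g1. - exact: f1. - exact: g2.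
Qed.

Lemma ctrlZ rho (c : K) B F : 0 <= rho -> ctrl rho B F ->
  ctrl rho (`|c| * B) (fun x => germC m c * F x).
Proof.
move=> r0 [f1 f2]; split=> [x bx|x y M bx by_ M0 hn].
  by apply: bndM => //; [apply: bndC|apply: f1].
by rewrite -mulrBr -mulrA; apply: bndM => //; [apply: bndC|apply: f2].
Qed.

Lemma ctrlX rho B F j : 0 <= rho -> ctrl rho B F ->
  ctrl rho ((2 * B) ^+ j) (fun x => F x ^+ j).
Proof.
move=> r0 h; elim: j => [|j IH].
  under [X in ctrl _ _ X]eq_fun do rewrite expr0; rewrite expr0.
  apply: ctrl_const => //; have := bndC om 1 r0; rewrite normr1; exact.
under [X in ctrl _ _ X]eq_fun do rewrite exprS.
by rewrite exprS -mulrA; apply: ctrlM.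
Qed.

Lemma ctrl_prod rho J (s : seq J) (B : J -> K) (F : J -> X -> germ K m) :
  0 <= rho -> (forall j, ctrl rho (B j) (F j)) ->
  ctrl rho (\prod_(j <- s) (2 * B j)) (fun x => \prod_(j <- s) F j x).
Proof.
move=> r0 h; elim: s => [|j s IH].
  under [X in ctrl _ _ X]eq_fun do rewrite big_nil; rewrite big_nil.
  apply: ctrl_const => //; have := bndC om 1 r0; rewrite normr1; exact.
under [X in ctrl _ _ X]eq_fun do rewrite big_cons.
by rewrite big_cons -mulrA; apply: ctrlM.
Qed.

(** [F] is of order [e] when it is of size [rho ^+ e] on the balls, with increments
    of the same order.  The lemmas below make the order of an explicit operator
    computable from its expression. *)
Definition bigO e F :=
  exists2 C, 0 <= C & small (fun rho => ctrl rho (C * rho ^+ e) F).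

Lemma bigO_ext e F G : F =1 G -> bigO e F -> bigO e G.
Proof. by move=> /funext ->. Qed.

Lemma bigO_weak e e' F : (e' <= e)%N -> bigO e F -> bigO e' F.
Proof.
move=> le [C C0 h]; exists C => //.
apply: small_mono (small_and h (small_le1 K)) => rho r0 [hF r1].
apply: (ctrl_le (ltW r0) _ hF); rewrite ler_wpM2l //.
by apply: ler_wiXn2l => //; apply: ltW.
Qed.

Lemma bigO_proj i : bigO (eps i) (fun x => x i).
Proof.
exists 1 => //; exists 1 => // rho r0 _; rewrite mul1r; split=> [x|x y M _ _ M0]; first exact.
by rewrite mulrC; apply.
Qed.

Lemma bigO_const (c : K) : bigO 0 (fun=> germC m c).
Proof.
exists `|c| => //; exists 1 => // rho /ltW r0 _; rewrite mulr1.
by apply: ctrl_const => //; apply: bndC.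
Qed.

Lemma bigO_var i : bigO (om i) (fun=> germX K i).
Proof.
exists 1 => //; exists 1 => // rho /ltW r0 _; rewrite mul1r.
by apply: ctrl_const => //; apply: bndX.
Qed.

Lemma bigOD e F G : bigO e F -> bigO e G -> bigO e (fun x => F x + G x).
Proof.
move=> [C C0 hF] [D D0 hG]; exists (C + D); first exact: addr_ge0.
apply: small_mono (small_and hF hG) => rho r0 [f g].
by rewrite mulrDl; apply: ctrlD => //; apply: ltW.
Qed.

Lemma bigON e F : bigO e F -> bigO e (fun x => - F x).
Proof.
move=> [C C0 hF]; exists C => //.
by apply: small_mono hF => rho _; apply: ctrlN.
Qed.

Lemma bigOB e F G : bigO e F -> bigO e G -> bigO e (fun x => F x - G x).
Proof. by move=> hF /bigON; apply: bigOD. Qed.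

Lemma bigOM e e' F G : bigO e F -> bigO e' G -> bigO (e + e') (fun x => F x * G x).
Proof.
move=> [C C0 hF] [D D0 hG]; exists (2 * (C * D)); first by rewrite !mulr_ge0.
apply: small_mono (small_and hF hG) => rho r0 [f g].
have -> : 2 * (C * D) * rho ^+ (e + e') = 2 * ((C * rho ^+ e) * (D * rho ^+ e')).
  by rewrite exprD; ring.
by apply: ctrlM => //; apply: ltW.
Qed.

Lemma bigOZ (c : K) e F : bigO e F -> bigO e (fun x => germC m c * F x).
Proof. exact: bigOM (bigO_const c). Qed.

Lemma bigOX e F j : bigO e F -> bigO (e * j) (fun x => F x ^+ j).
Proof.
move=> h; elim: j => [|j IH].
  rewrite muln0; apply: bigO_ext (bigO_const 1) => x; rewrite expr0 //.
by rewrite mulnS; apply: bigO_ext (bigOM h IH) => x; rewrite exprS.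
Qed.

Lemma bigO_rem w d e F : bigO e F -> bigO e (fun x => wrem w d (F x)).
Proof.
move=> [C C0 hF]; exists C => //.
apply: small_mono hF => rho /ltW r0 [f1 f2]; split=> [x bx|x y M bx by_ M0 hn].
  by apply: bnd_rem_coef => //; apply: f1.
by rewrite -remB; apply: bnd_rem_coef => //; apply: f2.
Qed.

(** Division is the only operation that loses order, and what it loses is the
    weight of the divisor. *)
Lemma bigO_quo w d e F : bigO (e + om w * d) F -> bigO e (fun x => wquo w d (F x)).
Proof.
move=> [C C0 hF]; exists C => //.
apply: small_mono hF => rho r0; rewrite exprD mulrA.
set D := rho ^+ (om w * d) => h.
have D0 : D != 0 by rewrite expf_neq0 // gt_eqF.
case: h => f1 f2; split=> [x bx|x y M bx by_ M0 hn].
  by rewrite -[_ * _](mulfK D0); apply: bnd_quo_coef => //; apply: f1.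
rewrite -quoB -[_ * M](mulfK D0); apply: bnd_quo_coef => //.
by rewrite mulrAC; apply: f2.
Qed.

(** Substituting in a fixed germ loses no radius of convergence, since [f]
    converges on a larger polydisc than those under consideration.  This is what
    allows a plain contraction argument. *)
Lemma bigO_comp (f : germ K m) N (Phi : X -> germ_map K m m) :
  (forall k, (wt om k < N)%N -> f k = 0) ->
  (forall i, bigO (om i) (fun x => Phi x i)) ->
  bigO N (fun x => germ_comp f (Phi x)).
Proof.
move=> fN hPhi.
have /choice[c hc] i : exists C, 0 <= C /\
    small (fun rho => ctrl rho (C * rho ^+ om i) (fun x => Phi x i)).
  by have [C C0 h] := hPhi i; exists C.
pose D := 1 + \sum_i c i; pose E := 2 * D.
have D1 : 1 <= D by rewrite lerDl sumr_ge0 // => i _; case: (hc i).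
have D0 : 0 <= D by apply: le_trans D1.
have E1 : 1 <= E by rewrite /E mulr_natl mulr2n (le_trans D1) // lerDl.
have cD i : c i <= D.
  rewrite /D (bigD1 i) //= addrCA lerDl addr_ge0 // sumr_ge0 // => j _.
  by case: (hc j).
have {}hc : small (fun rho => forall i, ctrl rho (D * rho ^+ om i) (fun x => Phi x i)).
  apply: small_all => i; have [ci0 h] := hc i.
  apply: small_mono h => rho /ltW r0; apply: ctrl_le => //.
  by rewrite ler_wpM2r ?exprn_ge0.
have [C C0 hC] := germ_small_bnd om_gt0 E1 fN.
exists (2 ^+ m * C); first by rewrite mulr_ge0 ?exprn_ge0.
apply: small_mono (small_and hc hC) => rho /ltW r0 [hP hf].
have key d : ctrl rho (2 ^+ m * C * rho ^+ N) (fun x => comp_upto d f (Phi x)).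
  have h (l : 'X_{1..m < d}) := ctrlZ (f l) r0 (ctrl_prod (index_enum 'I_m) r0
    (fun i => ctrlX (l i) r0 (hP i))).
  apply: ctrl_le (ctrl_sum (index_enum 'X_{1..m < d}) r0 h) => //.
  rewrite -mulrA; apply: le_trans (ler_wpM2l (exprn_ge0 m (ler0n _ 2)) (hf d)).
  rewrite mulr_sumr; apply: ler_sum => l _; rewrite mulrCA ler_wpM2l //.
  rewrite big_split /= prodr_const card_ord ler_wpM2l ?exprn_ge0 //.
  rewrite le_eqVlt; apply/orP; left; apply/eqP.
  rewrite mdegE -!prodrXr -big_split; apply: eq_bigr => i _ /=.
  by rewrite mulrA exprMn -exprM mulnC.
split=> [x bx|x y M bx by_ M0 hn].
  apply: bnd_lim => d; exists (comp_upto d f (Phi x)); first by have [k1 _] := key d; apply: k1.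
  by move=> k kd; apply: germ_comp_sum.
apply: bnd_lim => d; exists (comp_upto d f (Phi x) - comp_upto d f (Phi y)).
  by have [_ k2] := key d; apply: k2.
move=> k kd; rewrite -[LHS]/(germ_comp f (Phi x) k - germ_comp f (Phi y) k).
by rewrite !(germ_comp_sum _ _ kd).
Qed.

Lemma bigO_coef0 e F x k : bigO e F -> small (fun rho => ball rho x) ->
  (wt om k < e)%N -> F x k = 0.
Proof.
move=> [C C0 hF] hx ke; apply: (@small_eq0 K _ C (wt om k) e) => //.
apply: small_mono (small_and hF hx) => rho /ltW r0 [[h _] bx].
exact: bnd_coef r0 (h x bx).
Qed.

Variable T : X -> X.
Hypothesis T_order : forall i, bigO (eps i).+1 (fun x => T x i).

Lemma contraction : exists2 C, 0 <= C & small (fun rho =>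
   (forall x, ball rho x -> ball rho (T x)) /\
   (forall x y M, ball rho x -> ball rho y -> 0 <= M -> near rho M x y ->
      near rho (C * rho * M) (T x) (T y))).
Proof.
have /choice[c hc] i : exists C, 0 <= C /\
    small (fun rho => ctrl rho (C * rho ^+ (eps i).+1) (fun x => T x i)).
  by have [C C0 h] := T_order i; exists C.
pose C := \sum_i c i.
have C0 : 0 <= C by apply: sumr_ge0 => i _; case: (hc i).
have cC i : c i <= C.
  by rewrite /C (bigD1 i) //= lerDl sumr_ge0 // => j _; case: (hc j).
have {}hc : small (fun rho => forall i,
    ctrl rho (C * rho ^+ (eps i).+1) (fun x => T x i)).
  apply: small_all => i; have [ci0 h] := hc i.
  apply: small_mono h => rho /ltW r0; apply: ctrl_le => //.
  by rewrite ler_wpM2r ?exprn_ge0.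
exists C => //; apply: small_mono (small_and hc (small_le C0 ltr01)).
move=> rho /ltW r0 [h Cr]; split=> [x bx i|x y M bx by_ M0 hn i].
  have [h1 _] := h i; apply: bnd_le (h1 x bx).
  by rewrite exprS mulrA ler_piMl ?exprn_ge0.
have [_ h2] := h i; have := h2 x y M bx by_ M0 hn.
by rewrite exprS; congr (bnd _ _ _ _); ring.
Qed.

Lemma ball0 rho : 0 <= rho -> ball rho (fun=> 0).
Proof. by move=> r0 i; apply: bnd0; rewrite exprn_ge0. Qed.

Lemma near_sub rho M N x y z : 0 <= rho ->
  near rho M x y -> near rho N y z -> near rho (M + N) x z.
Proof.
move=> r0 h1 h2 i; have -> : x i - z i = (x i - y i) + (y i - z i) by ring.
by rewrite mulrDl; apply: bndD.
Qed.

Lemma ball_near rho x y : 0 <= rho -> ball rho x -> ball rho y -> near rho 2 x y.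
Proof. by move=> r0 hx hy i; rewrite mulr_natl mulr2n; apply: bndB. Qed.

(** Gaining one order makes [T] a contraction of ratio [C * rho] of each small
    ball.  As this holds for all small [rho], the iterates of 0 agree with each
    other to higher and higher weight: they converge by being eventually constant
    in each coefficient, and the limit inherits their bounds. *)
Theorem fixpoint : exists2 x, T x = x & small (fun rho => ball rho x).
Proof.
have [C C0 hC] := contraction.
pose s N := iter N T (fun=> 0 : germ K m).
have bs rho N : 0 < rho -> (forall x, ball rho x -> ball rho (T x)) -> ball rho (s N).
  by move=> r0 h; elim: N => [|N IH] /=; [apply: ball0; apply: ltW | apply: h].
have ns : small (fun rho => forall N (M : nat), ball rho (s N) /\
    near rho (2 * (C * rho) ^+ N) (s (N + M)%N) (s N)).
  apply: small_mono hC => rho r0 [h1 h2] N M; split; first exact: bs.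
  elim: N => [|N IH]; first by rewrite expr0 mulr1; apply: ball_near; rewrite ?ltW //; apply: bs.
  have -> : 2 * (C * rho) ^+ N.+1 = C * rho * (2 * (C * rho) ^+ N) by rewrite exprS; ring.
  apply: h2 IH; [exact: bs|exact: bs|].
  by rewrite mulr_ge0 ?exprn_ge0 ?mulr_ge0 // ltW.
(* A coefficient of weight j is constant from the iterate j.+1 on: its later
   variations are at most a constant times rho for every small rho. *)
have stable k i N : (wt om k < N)%N -> s N i k = s (wt om k).+1 i k.
  move=> kN; have -> : N = ((wt om k).+1 + (N - (wt om k).+1))%N by rewrite subnKC.
  set M := (_ - _)%N; apply/eqP; rewrite -subr_eq0; apply/eqP.
  apply: (@small_eq0 K _ (2 * C ^+ (wt om k).+1) (wt om k) (wt om k).+1) => //.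
  apply: small_mono (small_and ns (small_le1 K)) => rho /ltW r0 [h r1].
  have [_ /(_ i)/(bnd_coef k r0) hk] := h (wt om k).+1 M.
  apply: le_trans hk _; rewrite exprMn -!mulrA.
  rewrite ler_wpM2l // ler_wpM2l ?exprn_ge0 //.
  by rewrite ler_piMr ?exprn_ge0 // exprn_ile1.
pose lim i (k : 'X_{1..m}) := s (wt om k).+1 i k.
have lim_eq d : exists N0, forall N i k, (N0 <= N)%N -> (mdeg k < d)%N -> lim i k = s N i k.
  exists ((\sum_i om i) * d).+1 => N i k hN kd; rewrite /lim (stable k i N) //.
  apply: leq_trans hN; rewrite ltnS; apply: leq_trans (wt_le_mdeg om k) _.
  by rewrite leq_mul2l ltnW ?orbT.
have blim : small (fun rho => forall i, bnd om rho (rho ^+ eps i) (lim i)).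
  apply: small_mono ns => rho r0 h i; apply: bnd_lim => d.
  have [N hN] := lim_eq d; exists (s N i); first by have [] := h N 0%N.
  by move=> k; apply: hN.
have clim i : convergent (lim i).
  have [rho r0 [h r1]] := small_ex (small_and blim (small_le1 K)).
  exact: bnd_convergent r0 r1 (h i).
exists (fun i => Germ (clim i)) => //; set x := fun i => _.
apply/funext => i; apply: germP => k.
apply/eqP; rewrite -subr_eq0; apply/eqP.
pose N := (wt om k).+1.
apply: (@small_eq0 K _ (4 * C ^+ N) (wt om k) N) => //.
apply: small_mono (small_and (small_and hC ns) (small_and blim (small_le1 K))).
move=> rho r0 [[[h1 h2] hs] [bx r1]]; have rho0 := ltW r0.
have nx (M : nat) : near rho (2 * (C * rho) ^+ M) x (s M).
  move=> j; apply: bnd_lim => d; have [N1 hN] := lim_eq d.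
  exists (s (M + N1)%N j - s M j); first by have [_] := hs M N1; apply.
  by move=> l ld; rewrite /= -(hN (M + N1)%N) // leq_addl.
have nT : near rho (4 * (C * rho) ^+ N) (T x) x.
  have -> : 4 * (C * rho) ^+ N = 2 * (C * rho) ^+ N + 2 * (C * rho) ^+ N by ring.
  apply: (@near_sub _ _ _ _ (s N)) => //.
    have -> : 2 * (C * rho) ^+ N = C * rho * (2 * (C * rho) ^+ (wt om k)) by rewrite exprS; ring.
    apply: (h2 x (s (wt om k))) => //; first exact: bs.
    by rewrite mulr_ge0 ?exprn_ge0 ?mulr_ge0.
  by move=> j; rewrite -opprB; apply/bndN/nx.
apply: le_trans (bnd_coef k rho0 (nT i)) _; rewrite exprMn -!mulrA.
rewrite ler_wpM2l // ler_wpM2l ?exprn_ge0 //.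
by rewrite ler_piMr ?exprn_ge0 // exprn_ile1.
Qed.

End Operators.

(** * Changes of the last coordinate *)

Section Shear.
Variables (K : numFieldType) (n : nat).
Notation w := (ord_max : 'I_n.+1).
Notation W := (germX K w).
Implicit Types theta eta : germ K n.+1.

Fact shear_comp0 theta (i : 'I_n.+1) :
  (if i == w then W * theta else germX K i) 0%MM = 0.
Proof.
by case: ifP => _; rewrite ?coef_germM0 germX0 ?mul0r.
Qed.
(** The change of coordinate (z, w) -> (z, w theta(z, w)). *)
Definition shear theta : germ_map K n.+1 n.+1 := GermMap (shear_comp0 theta).

Lemma shear_w theta : shear theta w = W * theta.
Proof. by rewrite /= eqxx. Qed.

Lemma shear_neq theta i : i != w -> shear theta i = germX K i.
Proof. by move=> /negPf /= ->. Qed.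

Lemma comp_shearW theta : germ_comp W (shear theta) = W * theta.
Proof. by rewrite germ_compX shear_w. Qed.

Lemma comp_shear_affine theta f (c1 c2 : K) d :
  germ_comp (germC n.+1 c1 * f + germC n.+1 c2 * W ^+ d) (shear theta) =
  germC n.+1 c1 * germ_comp f (shear theta) + germC n.+1 c2 * (W * theta) ^+ d.
Proof.
rewrite -[LHS]/(pull _ _) rmorphD !rmorphM rmorphXn /= /pull.
by rewrite !germ_compC comp_shearW.
Qed.

Lemma bigO_shear (om : 'I_n.+1 -> nat) (I : finType) (eps : I -> nat) F :
  bigO om eps 0 F -> forall i, bigO om eps (om i) (fun x => shear (F x) i).
Proof.
move=> hF i; have [->|iw] := eqVneq i w.
  rewrite -[om w]addn0; apply: bigO_ext (bigOM (bigO_var K om eps w) hF) => x.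
  by rewrite shear_w.
by apply: bigO_ext (bigO_var K om eps i) => x; rewrite shear_neq.
Qed.

Lemma wt_ge (om : 'I_n.+1 -> nat) (k : 'X_{1..n.+1}) i : (k i * om i <= wt om k)%N.
Proof. by rewrite /wt (bigD1 i) //= leq_addr. Qed.

(** With t = theta(0) and E = theta / t - 1, the unknown eta = (1 + y) / t has to
    satisfy y = - (1 + y) E(z, w eta).  As E vanishes at the origin, the right-hand
    side has order 2 when [y] has order 1 and all variables have weight 2. *)
Lemma shear_right_inverse theta : theta 0%MM != 0 ->
  exists2 eta : germ K n.+1, eta 0%MM != 0 & eta * germ_comp theta (shear eta) = 1.
Proof.
set t := theta 0%MM => t0.
pose om (i : 'I_n.+1) := 2%N; pose eps (_ : unit) := 1%N.
pose E := germC n.+1 t^-1 * theta - 1.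
have E0 k : (wt om k < 2)%N -> E k = 0.
  move=> hk; have -> : k = 0%MM.
    apply/mnmP => i; rewrite mnm0E; move: (leq_ltn_trans (wt_ge om k i) hk).
    by case: (k i).
  rewrite -[LHS]/((germC n.+1 t^-1 * theta) 0%MM - germC n.+1 1 0%MM).
  by rewrite coef_germCM coef_germC0 mulVf // subrr.
pose eta (x : unit -> germ K n.+1) := germC n.+1 t^-1 * (1 + x tt).
pose T (x : unit -> germ K n.+1) (_ : unit) := - ((1 + x tt) * germ_comp E (shear (eta x))).
have o1 : bigO om eps 0 (fun x : unit -> germ K n.+1 => 1 + x tt).
  apply: bigOD; first exact: (bigO_const om eps 1).
  exact: bigO_weak (bigO_proj K om eps tt).
have [i|x xT _] := @fixpoint K n.+1 om _ eps T.
  apply: bigON; apply: (@bigOM _ _ _ _ _ 0 2) => //.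
  by apply: bigO_comp E0 _ => //; apply: bigO_shear; apply: bigOZ.
have e1 : eta x * germ_comp theta (shear (eta x)) = 1.
  have := congr1 (fun y => y tt) xT; rewrite /T => e.
  have {}e : (1 + x tt) * (1 + germ_comp E (shear (eta x))) = 1.
    have -> : (1 + x tt) * (1 + germ_comp E (shear (eta x))) =
        1 + (x tt - (- ((1 + x tt) * germ_comp E (shear (eta x))))) by ring.
    by rewrite e subrr addr0.
  have -> : eta x * germ_comp theta (shear (eta x)) =
      (1 + x tt) * (germC n.+1 t^-1 * germ_comp theta (shear (eta x))).
    by rewrite /eta; ring.
  rewrite -[RHS]e; congr (_ * _); rewrite /E.
  rewrite -[germ_comp (_ - _) _]/(pull _ _) rmorphB rmorphM rmorph1.
  by rewrite /= /pull germ_compC; ring.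
exists (eta x) => //; apply/eqP => z0.
have : (eta x * germ_comp theta (shear (eta x))) 0%MM = germC n.+1 1 0%MM by rewrite e1.
by rewrite coef_germC0 coef_germM0 z0 mul0r => /eqP; rewrite eq_sym oner_eq0.
Qed.

Lemma comp_shear_inverse theta eta i : eta * germ_comp theta (shear eta) = 1 ->
  germ_comp (shear theta i) (shear eta) = germX K i.
Proof.
move=> e; have [->|iw] := eqVneq i w; last by rewrite shear_neq // germ_compX shear_neq.
by rewrite shear_w germ_compM comp_shearW -mulrA e mulr1.
Qed.

(** A right inverse of a shear is a shear, which has a right inverse in turn; in
    a monoid this makes them inverse to each other. *)
Lemma shear_w_change theta : theta 0%MM != 0 -> w_change (shear theta).
Proof.
move=> /shear_right_inverse[eta /shear_right_inverse[chi _ e2] e1].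
have h1 i := comp_shear_inverse i e1; have h2 i := comp_shear_inverse i e2.
have e : shear theta = shear chi.
  apply: germ_mapP => i.
  pose Id := germ_map_comp (shear eta) (shear chi).
  rewrite -[LHS](@germ_comp_id _ _ _ Id h2).
  by rewrite -germ_compA h1 germ_compX.
split; last by move=> i; rewrite shear_neq // eq_sym neq_lift.
by exists (shear eta) => i; split; rewrite // e.
Qed.

Lemma comp_shear_neq0 theta f : theta 0%MM != 0 -> f != 0 -> germ_comp f (shear theta) != 0.
Proof.
move=> /shear_right_inverse[eta _ e]; apply: contraNneq => f0.
have h i := comp_shear_inverse i e.
rewrite -[f](germ_comp_id (Phi := germ_map_comp (shear theta) (shear eta)) _ h).
by rewrite -germ_compA f0 -/(pull _ _) rmorph0.
Qed.

(** The part of degree at least 2 of the binomial expansion. *)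
Lemma bigO_pow (om : 'I_n.+1 -> nat) (I : finType) (eps : I -> nat)
    (F : (I -> germ K n.+1) -> germ K n.+1) j :
  bigO om eps 1 F -> bigO om eps 2 (fun x => (1 + F x) ^+ j - 1 - j%:R * F x).
Proof.
move=> hF; have F0 : bigO om eps 0 (fun x => 1 + F x).
  by apply: bigOD (bigO_weak _ hF) => //; apply: (bigO_const om eps 1).
have hFF := bigOM hF hF.
elim: j => [|j IH].
  by apply: bigO_ext (bigOB hFF hFF) => x; rewrite expr0; ring.
apply: bigO_ext (bigOD (bigOM F0 IH) (bigOM (bigO_const om eps j%:R) hFF)) => x.
by rewrite rmorph_nat exprS -natr1; ring.
Qed.

(** * The simultaneous preparation of two germs *)

Section Preparation.
Variables (P : bool -> germ K n.+1) (deg : bool -> nat) (c : bool -> K) (t al : K).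
Let a := deg true.
Let b := deg false.
Hypothesis P_lt : forall i j, (j < deg i)%N -> P i (U_(w) *+ j)%MM = 0.
Hypothesis P_eq : forall i, P i (U_(w) *+ deg i)%MM = c i.
Hypothesis ab : a != b.
Hypothesis t0 : t != 0.
Hypothesis al0 : al != 0.
Hypothesis ct : forall i, c i * t ^+ deg i = al.

(* Weight 2 for [w] leaves room for the order 1 of the unknowns [tau] and [sigma].
   The other variables are so heavy that any monomial containing one of them has
   at least the weight of w ^ (deg i + 1). *)
Let om (i : 'I_n.+1) := if i == w then 2%N else (2 * (a + b).+1)%N.
(* x i stands for w ^ (deg i) times a germ of order 1. *)
Let eps i := (2 * deg i).+1.
Let E i := germC n.+1 al^-1 * (P i - germC n.+1 (c i) * W ^+ deg i).

Let om_gt0 i : (0 < om i)%N.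
Proof. by rewrite /om; case: ifP. Qed.

Let deg_le i : (deg i <= a + b)%N.
Proof. by case: i; [apply: leq_addr|apply: leq_addl]. Qed.

Let E_small i k : (wt om k < 2 * (deg i).+1)%N -> E i k = 0.
Proof.
move=> hk; have kj : k = (U_(w) *+ k w)%MM.
  apply/mnmP => j; rewrite mulmnE mnm1E; have [->|jw] := eqVneq j w.
    by rewrite mul1n.
  rewrite mul0n; move: (leq_ltn_trans (wt_ge om k j) hk).
  rewrite /om (negPf jw); case: (k j) => // l; rewrite ltnNge; case/negP.
  by apply: leq_trans (leq_pmull _ _); rewrite // leq_mul2l ltnS deg_le.
have kd : (k w <= deg i)%N.
  move: (leq_ltn_trans (wt_ge om k w) hk).
  by rewrite /om eqxx mulnC ltn_mul2l ltnS.
rewrite coef_germCM -[(P i - _) k]/(P i k - (germC n.+1 (c i) * W ^+ deg i) k).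
rewrite coef_germCM coef_Xn; move: kd; rewrite leq_eqVlt => /orP[/eqP e|lt].
  by rewrite -e -kj eqxx mulr1 kj e P_eq subrr mulr0.
rewrite {1}kj P_lt // [k == _](_ : _ = false) ?mulr0 ?subr0 ?mulr0 //.
apply/eqP => /(congr1 (fun k : 'X_{1..n.+1} => k w)) /=.
by rewrite mulmnE mnm1E eqxx mul1n => e; move: lt; rewrite e ltnn.
Qed.

Let ba : (b%:R - a%:R : K) != 0.
Proof. by rewrite subr_eq0 eqr_nat eq_sym. Qed.

Notation X := (bool -> germ K n.+1).
Let D : germ K n.+1 := germC n.+1 (b%:R - a%:R)^-1.
(* [sigma] and [tau] solve sigma - deg i * tau = u i for both values of [i];
   this linear system is where the degrees have to be distinct. *)
Let u (x : X) i : germ K n.+1 := wquo w (deg i) (x i).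
Let tau x := D * (u x true - u x false).
Let sigma x := D * (b%:R * u x true - a%:R * u x false).
Let theta x := germC n.+1 t * (1 + tau x).
(* The equation x i = T x i says that (w ^ d + r) (1 + sigma) is equal to
   w ^ d (1 + tau) ^ d + E i (z, w theta), for d = deg i and r the remainder of
   x i by w ^ d. *)
Let T (x : X) i : germ K n.+1 :=
  germ_comp (E i) (shear (theta x)) - wrem w (deg i) (x i) * sigma x
  + W ^+ deg i * ((1 + tau x) ^+ deg i - 1 - (deg i)%:R * tau x).

Let Dba : D * (b%:R - a%:R) = 1.
Proof. by rewrite -!(rmorph_nat (@germC K n.+1)) -rmorphB -rmorphM mulVf // rmorph1. Qed.

Let sigma_tau x i : sigma x - (deg i)%:R * tau x = u x i.
Proof.
case: i; rewrite /sigma /tau -/a -/b -[RHS]mul1r -[X in _ = X * _]Dba; ring.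
Qed.

Let bigO_u i : bigO om eps 1 (fun x => u x i).
Proof.
apply: bigO_quo; rewrite add1n /om eqxx; exact: (bigO_proj K om eps i).
Qed.
Let bigO_tau : bigO om eps 1 tau.
Proof. by apply/bigOZ/bigOB; apply: bigO_u. Qed.
Let bigO_sigma : bigO om eps 1 sigma.
Proof.
have h := bigOB (bigOZ b%:R (bigO_u true)) (bigOZ a%:R (bigO_u false)).
apply: bigO_ext (bigOZ (b%:R - a%:R)^-1 h) => x.
by rewrite !rmorph_nat.
Qed.
Let bigO_theta : bigO om eps 0 theta.
Proof.
apply: bigOZ; apply: bigOD; first exact: (bigO_const om eps 1).
exact: bigO_weak bigO_tau.
Qed.

Let bigO_T i : bigO om eps (eps i).+1 (fun x => T x i).
Proof.
have e2 : (eps i).+1 = (2 * (deg i).+1)%N by rewrite /eps mulnS.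
apply: bigOD; first apply: bigOB.
- rewrite e2; apply: bigO_comp (@E_small i) _ => //.
  exact: bigO_shear bigO_theta.
- rewrite -[(eps i).+1]addn1; apply: bigOM bigO_sigma; apply: bigO_rem.
  exact: (bigO_proj K om eps i).
- rewrite e2 mulnS addnC; apply: bigOM (bigO_pow _ bigO_tau).
  have omw : om w = 2%N by rewrite /om eqxx.
  by have := bigOX (deg i) (bigO_var K om eps w); rewrite omw.
Qed.

(** If P i (0, w) has order exactly [deg i], with distinct degrees, one shear
    makes both germs monic polynomials in [w] times a common factor.  Writing
    P i = c i w ^ d + (heavier terms), the leading terms impose
    theta(0) = t with c i t ^ d independent of [i]; theta = t (1 + tau), the common
    factor al (1 + sigma) and the two remainders then form a fixed point of
    [T]. *)
Lemma w_preparation : exists2 th : germ K n.+1, th 0%MM != 0 &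
  exists al_ : germ K n.+1, exists r : bool -> germ K n.+1,
  forall i, germ_comp (P i) (shear th) = (W ^+ deg i + wrem w (deg i) (r i)) * al_.
Proof.
have [x xT bx] := fixpoint bigO_T.
exists (theta x).
  rewrite coef_germCM mulf_neq0 // -[(1 + tau x) 0%MM]/(germC n.+1 1 0%MM + tau x 0%MM).
  by rewrite (bigO_coef0 bigO_tau bx) ?wt0 // addr0 coef_germC0 oner_eq0.
exists (germC n.+1 al * (1 + sigma x)), x => i.
have eP : P i = germC n.+1 al * E i + germC n.+1 (c i) * W ^+ deg i.
  by rewrite /E mulrA -rmorphM mulfV // mul1r subrK.
rewrite {1}eP comp_shear_affine.
have := congr1 (fun y => y i) xT; rewrite /T.
set G := germ_comp _ _; set r := wrem _ _ _ => e.
have {}e : G = W ^+ deg i * u x i + r + r * sigma x -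
    W ^+ deg i * ((1 + tau x) ^+ deg i - 1 - (deg i)%:R * tau x).
  by rewrite quo_rem -e; ring.
rewrite e -sigma_tau /theta !exprMn.
have -> : germC n.+1 (c i) * (W ^+ deg i * (germC n.+1 t ^+ deg i * (1 + tau x) ^+ deg i)) =
   germC n.+1 al * (W ^+ deg i * (1 + tau x) ^+ deg i).
  by rewrite -(ct i) rmorphM rmorphXn; ring.
by ring.
Qed.

End Preparation.
End Shear.

(** * Polynomials in w and restriction to the w-axis *)

Section Polynomials.
Variables (K : numFieldType) (n : nat).
Notation w := (ord_max : 'I_n.+1).
Notation W := (germX K w).
Implicit Types (k : 'X_{1..n.+1}) (l : 'X_{1..n}) (g h : germ K n.+1).

Lemma mdeg_mnmwiden l : mdeg (mnmwiden l) = mdeg l.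
Proof.
rewrite !mdegE big_ord_recr /= mnmwiden_ordmax addn0.
by apply: eq_bigr => i _; rewrite mnmwiden_widen.
Qed.

Definition zpart k : 'X_{1..n} := [multinom k (lift w i) | i < n].

Lemma zpartK k : (mnmwiden (zpart k) + U_(w) *+ k w)%MM = k.
Proof.
apply/mnmP => i; rewrite mnmDE mulmnE mnm1E.
case: (unliftP w i) => [j|] ->.
  rewrite (negPf (neq_lift _ _)) mul0n addn0.
  have -> : lift w j = widen_ord (leqnSn n) j.
    by apply: val_inj => /=; rewrite /bump leqNgt ltn_ord.
  rewrite mnmwiden_widen mnmE; congr (k _).
  by apply: val_inj => /=; rewrite /bump leqNgt ltn_ord.
by rewrite mnmwiden_ordmax eqxx mul1n.
Qed.

Lemma comp_coordz_upto d (c : germ K n) :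
  comp_upto d c (coordz K n) =
  \sum_(l : 'X_{1..n < d}) germC n.+1 (c l) * germXm K (mnmwiden l).
Proof.
apply: eq_bigr => l _; congr (_ * _); rewrite /germXm big_ord_recr /=.
rewrite mnmwiden_ordmax expr0 mulr1; apply: eq_bigr => i _.
rewrite mnmwiden_widen; congr (germX K _ ^+ _).
by apply: val_inj => /=; rewrite /bump leqNgt ltn_ord.
Qed.

Lemma coef_comp_coordz (c : germ K n) k :
  germ_comp c (coordz K n) k = if k w == 0%N then c (zpart k) else 0.
Proof.
have kd := ltnSn (mdeg k).
rewrite (germ_comp_sum _ _ kd) comp_coordz_upto coef_germ_sum.
under eq_bigr do rewrite coef_germCM coef_Xm.
case: eqP => k0; last first.
  rewrite big1 // => l _; case: eqP => [e|_]; last by rewrite mulr0.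
  by case: k0; rewrite -e mnmwiden_ordmax.
have e : mnmwiden (zpart k) = k by rewrite -[RHS]zpartK k0 mulm0n addm0.
have zd : (mdeg (zpart k) < (mdeg k).+1)%N.
  by rewrite -{2}e ltnS mdeg_mnmwiden.
rewrite (bigD1 (BMultinom zd)) //= e eqxx mulr1 big1 ?addr0 // => l lz.
case: eqP => [el|]; last by rewrite mulr0.
case/eqP: lz; apply: val_inj; apply: inj_mnmwiden; exact: etrans el (esym e).
Qed.

Lemma convergent_wcoef h i : convergent (fun l => h (mnmwiden l + U_(w) *+ i)%MM).
Proof.
have [r [M [r0 r1 hM]]] := germ_bnd1 h.
exists r, (M / r ^+ i); split=> // d; rewrite ler_pdivlMr ?exprn_gt0 // mulr_suml.
have inj : injective (fun l : 'X_{1..n < d} => (mnmwiden l + U_(w) *+ i)%MM).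
  by move=> k k' /addIm /inj_mnmwiden /val_inj.
have us : uniq [seq (mnmwiden l + U_(w) *+ i)%MM | l : 'X_{1..n < d}].
  by rewrite map_inj_uniq // enum_uniq.
apply: le_trans (bnd_seq (ltW r0) hM us).
rewrite big_image /=; apply: ler_sum => l _.
rewrite -mulrA -exprD; suff -> : wt (fun=> 1%N) (mnmwiden l + U_(w) *+ i) = (mdeg l + i)%N by [].
rewrite wtD wtUn mul1n -mdeg_mnmwiden [in RHS]mdegE; congr (_ + _)%N.
by apply: eq_bigr => j _; rewrite muln1.
Qed.
Definition wcoef h i : germ K n := Germ (convergent_wcoef h i).

Lemma w_monicP d h :
  (forall k, (d <= k w)%N -> h k = (k == U_(w) *+ d)%MM%:R) ->
  h = w_monic (fun i : 'I_d => wcoef h i).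
Proof.
move=> hh; apply: germP => k; rewrite /w_monic /coordw.
pose S : germ K n.+1 := \sum_(i < d) germ_comp (wcoef h i) (coordz K n) * W ^+ i.
rewrite -[RHS]/(S k + (W ^+ d) k) coef_germ_sum coef_Xn.
under eq_bigr do rewrite mulrC coef_XnM coef_comp_coordz.
have sub i : (i <= k w)%N -> (k - U_(w) *+ i)%MM w = (k w - i)%N.
  by move=> _; rewrite mnmBE mulmnE mnm1E eqxx mul1n.
have [dk|kd] := leqP d (k w).
  rewrite hh // big1 ?add0r // => i _.
  have ik : (i < k w)%N by apply: leq_trans dk.
  by rewrite (ltnW ik) sub ?(ltnW ik) // subn_eq0 leqNgt ik.
rewrite (bigD1 (Ordinal kd)) //= leqnn sub // subnn eqxx big1 => [|i ik].
  rewrite addr0 (_ : (k == _) = false) ?addr0 /=; last first.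
    apply/eqP => /(congr1 (fun k => k w)); rewrite /= mulmnE mnm1E eqxx mul1n.
    by move=> e; rewrite e ltnn in kd.
  congr (h _); rewrite -[LHS]zpartK; congr (mnmwiden _ + _)%MM.
  apply/mnmP => j; rewrite [LHS]mnmE [RHS]mnmE mnmBE mulmnE mnm1E.
  by rewrite (negPf (neq_lift _ _)) mul0n subn0.
case: ifP => // ik'; rewrite sub // subn_eq0; case: ifP => // ki.
by case/eqP: ik; apply: val_inj; apply/eqP; rewrite eqn_leq ik'.
Qed.

(** Setting z = 0 keeps exactly the coefficients of the pure powers of [w]. *)
Lemma coef_w_axis (p : germ K n.+1) j :
  germ_comp p (w_axis K n) (U_(ord0) *+ j)%MM = p (U_(w) *+ j)%MM.
Proof.
set k := (_ *+ _)%MM; have kd := ltnSn (mdeg k).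
rewrite (germ_comp_sum _ _ kd) coef_germ_sum.
have mono (l : 'X_{1..n.+1}) : \prod_i w_axis K n i ^+ l i =
    if l == (U_(w) *+ l w)%MM then germX K ord0 ^+ l w else (0 : germ K 1).
  case: eqP => [->|ne].
    rewrite (bigD1 w) //= eqxx big1 ?mulr1 => [|i /negPf iw].
      by rewrite !mulmnE mnm1E eqxx mul1n.
    by rewrite mulmnE mnm1E [w == i]eq_sym iw mul0n expr0.
  have [i iw li] : exists2 i, i != w & l i != 0%N.
    apply: contrapT => h; apply: ne; apply/mnmP => i; rewrite mulmnE mnm1E.
    have [->|iw] := eqVneq i w; first by rewrite mul1n.
    rewrite mul0n; apply/eqP/negPn/negP => li; apply: h; by exists i.
  by rewrite (bigD1 i) //= (negPf iw) expr0n (negPf li) mul0r.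
have kdeg : mdeg (U_(w) *+ j : 'X_{1..n.+1})%MM = mdeg k by rewrite !mdegMn !mdeg1.
have kd' : (mdeg (U_(w) *+ j : 'X_{1..n.+1})%MM < (mdeg k).+1)%N by rewrite kdeg.
have jE (m : nat) (i : 'I_m) a : (U_(i) *+ a)%MM i = a by rewrite mulmnE mnm1E eqxx mul1n.
rewrite (bigD1 (BMultinom kd')) // -[LHS]/(_ + _) [X in _ + X]big1 ?addr0 => [|l lk].
  by rewrite coef_germCM mono jE eqxx coef_Xn eqxx mulr1.
rewrite coef_germCM mono; case: eqP => [lE|_]; last by rewrite /= if_same mulr0.
rewrite coef_Xn; case: eqP => [e|_]; last by rewrite mulr0.
case/eqP: lk; apply: val_inj => /=; rewrite lE; congr (_ *+ _)%MM.
by move/(congr1 (fun k : 'X_{1..1} => k ord0)): e; rewrite /k !jE.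
Qed.

(** The order of vanishing of p(0, w) at w = 0, when it is finite. *)
Definition w_order (p : germ K n.+1) a :=
  p (U_(w) *+ a)%MM != 0 /\ forall j, (j < a)%N -> p (U_(w) *+ j)%MM = 0.

Lemma w_order_exists p : germ_comp p (w_axis K n) != 0 -> exists a, w_order p a.
Proof.
move=> p0; have ex : exists a, p (U_(w) *+ a)%MM != 0.
  apply: contrapT => h; case/eqP: p0; apply: germP => k /=.
  rewrite if_same; have -> : k = (U_(ord0) *+ k ord0)%MM.
    by apply/mnmP => i; rewrite mulmnE mnm1E ord1 eqxx mul1n.
  rewrite -[LHS]/(germ_comp p _ _) coef_w_axis.
  by apply/eqP/negPn/negP => pa; apply: h; eexists; exact: pa.
case: (ex_minnP ex) => a pa min; exists a; split=> // j ja.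
by apply/eqP/negPn/negP => /min; rewrite leqNgt ja.
Qed.

End Polynomials.

(** * The normal form *)

Section NormalForm.
Variables (K : numClosedFieldType) (n : nat).
Notation w := (ord_max : 'I_n.+1).
Notation W := (germX K w).
Implicit Types (p q f : germ K n.+1) (k : 'X_{1..n.+1}).

(** Extracting a root of order |a - b|. *)
Lemma balance (x y : K) a b : x != 0 -> y != 0 -> a != b ->
  exists2 t, t != 0 & x * t ^+ a = y * t ^+ b.
Proof.
wlog ab : x y a b / (a < b)%N => [hw x0 y0 ne|x0 y0 _].
  have [lt|lt|e] := ltngtP a b; first exact: hw.
    by have [t t0 e] := hw y x b a lt y0 x0 (negbT (ltn_eqF lt)); exists t.
  by rewrite e eqxx in ne.
have ba : (0 < b - a)%N by rewrite subn_gt0.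
have xy : (b - a).-root (x / y) ^+ (b - a) = x / y by rewrite rootCK.
exists ((b - a).-root (x / y)).
  apply: contraTneq isT => z; move: xy; rewrite z expr0n gtn_eqF //= => /esym/eqP.
  by rewrite mulf_eq0 invr_eq0 (negPf x0) (negPf y0).
by rewrite -[X in _ = _ * _ ^+ X](subnK (ltnW ab)) exprD xy mulrA mulrCA divff ?mulr1.
Qed.

Lemma w_rational_form p q a b : w_order p a -> w_order q b -> a != b ->
  exists th al A B : germ K n.+1,
  [/\ th 0%MM != 0, germ_comp p (shear th) = (W ^+ a + wrem w a A) * al &
      germ_comp q (shear th) = (W ^+ b + wrem w b B) * al].
Proof.
move=> [pa pl] [qb ql] ab; have [t t0 tE] := balance pa qb ab.
have [||||||th th0 [al [r h]]] := @w_preparation K n (fun i => if i then p else q)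
  (fun i => if i then a else b) (fun i => if i then p (U_(w) *+ a)%MM else q (U_(w) *+ b)%MM)
  t (p (U_(w) *+ a)%MM * t ^+ a) => //; try by case.
- by rewrite mulf_neq0 // expf_neq0.
by exists th, al, (r true), (r false); split; [|exact: (h true)|exact: (h false)].
Qed.

(** If p(0, w) and q(0, w) have the same order, subtracting from f the value of
    f(0, w) at w = 0 raises the order of the numerator.  Adding the constant back
    afterwards must keep the numerator monic, whence the last clause. *)
Lemma separate_orders p q b : w_order q b ->
  (forall c, germ_comp (p - germC n.+1 c * q) (w_axis K n) != 0) ->
  exists c a, [/\ w_order (p - germC n.+1 c * q) a, a != b & c = 0 \/ (b < a)%N].
Proof.
move=> [qb ql] hc.
have [a0 ha0] := w_order_exists (hc 0).
have [e|ne] := eqVneq a0 b; last by exists 0, a0; split=> //; left.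
pose c := p (U_(w) *+ b)%MM / q (U_(w) *+ b)%MM.
have [a ha] := w_order_exists (hc c); exists c, a.
suff ba : (b < a)%N by split=> //; [rewrite gtn_eqF | right].
have sub d k : (p - germC n.+1 d * q) k = p k - d * q k.
  by rewrite -[LHS]/(p k - (germC n.+1 d * q) k) coef_germCM.
rewrite ltnNge; apply/negP => le; case: ha => /eqP; case; rewrite sub.
move: le; rewrite leq_eqVlt => /orP[/eqP ->|lt].
  by rewrite divfK // subrr.
rewrite ql // mulr0 subr0.
by have [_ /(_ a)] := ha0; rewrite sub mul0r subr0 e; apply.
Qed.

Lemma monic_coef a (A : germ K n.+1) k : (a <= k w)%N ->
  (W ^+ a + wrem w a A) k = (k == U_(w) *+ a)%MM%:R.
Proof.
move=> ak; rewrite -[LHS]/((W ^+ a) k + rem_coef w a A k) coef_Xn.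
by rewrite /rem_coef ltnNge ak addr0.
Qed.

Lemma monic_w_monic a (A : germ K n.+1) :
  exists gs : 'I_a -> germ K n, W ^+ a + wrem w a A = w_monic gs.
Proof. by eexists; apply: w_monicP => k ak; apply: monic_coef. Qed.

Lemma add_w_monic a b (A B : germ K n.+1) c : c = 0 \/ (b < a)%N ->
  exists fs : 'I_a -> germ K n,
    W ^+ a + wrem w a A + germC n.+1 c * (W ^+ b + wrem w b B) = w_monic fs.
Proof.
move=> cb; eexists; apply: w_monicP => k ak.
rewrite -[LHS]/((W ^+ a + wrem w a A) k + (germC n.+1 c * (W ^+ b + wrem w b B)) k).
rewrite monic_coef // coef_germCM; case: cb => [->|ba]; first by rewrite mul0r addr0.
have kb : k != (U_(w) *+ b)%MM.
  apply: contraTneq ak => ->.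
  by rewrite mulmnE mnm1E eqxx mul1n -ltnNge.
by rewrite monic_coef ?(leq_trans (ltnW ba)) // (negPf kb) mulr0 addr0.
Qed.

Theorem w_rational (f : {fraction germ K n.+1}) (f0 : {fraction germ K 1}) :
  is_pullback f (w_axis K n) f0 ->
  (forall c : K, f0 <> FracField.tofrac (germC 1 c)) ->
  exists (Phi : germ_map K n.+1 n.+1) (k0 kinf : nat)
         (fs : 'I_k0 -> germ K n) (gs : 'I_kinf -> germ K n),
    w_change Phi /\
    is_pullback f Phi
      (FracField.tofrac (w_monic fs) / FracField.tofrac (w_monic gs)).
Proof.
move=> [p [q [cpq [q0 fE] qaxis f0E]]] nc.
have [b hb] := w_order_exists qaxis.
have frac0 m (g : germ K m) : g != 0 -> FracField.tofrac g != 0.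
  by rewrite tofrac_eq0.
have [c|c [a [ha ab cb]]] := @separate_orders p q b hb.
  apply/eqP => e; apply: (nc c); rewrite f0E.
  have -> : germ_comp p (w_axis K n) = germC 1 c * germ_comp q (w_axis K n).
    apply/eqP; rewrite -subr_eq0 -{}e.
    by rewrite -[germ_comp (_ - _) _]/(pull _ _) rmorphB rmorphM /= /pull germ_compC.
  by rewrite rmorphM /= mulfK // frac0.
have [th [al [A [B [th0 eA eB]]]]] := w_rational_form ha hb ab.
have [gs gsE] := monic_w_monic b B; have [fs fsE] := add_w_monic A B cb.
have qP := comp_shear_neq0 th0 q0.
have al0 : al != 0 by apply: contraNneq qP => al0; rewrite eB al0 mulr0.
exists (shear th), a, b, fs, gs; split; first exact: shear_w_change.
exists p, q; split=> //.
have -> : germ_comp p (shear th) = w_monic fs * al.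
  rewrite -fsE mulrDl -eA -mulrA -eB.
  rewrite -[germ_comp (_ - _) _]/(pull _ _) rmorphB rmorphM /= /pull germ_compC.
  by rewrite subrK.
have -> : germ_comp q (shear th) = w_monic gs * al by rewrite -gsE.
by rewrite !rmorphM /= -mulf_div divff ?mulr1 ?frac0.
Qed.

End NormalForm.

Theorem theorem2p1 (R : realType) (n : nat) (hn : (1 <= n)%N)
    (f : {fraction germ R[i]%C n.+1})
    (f0 : {fraction germ R[i]%C 1})
    (hf0 : is_pullback f (w_axis R[i]%C n) f0)
    (hnc : forall c : R[i]%C, f0 <> FracField.tofrac (germC 1 c)) :
  exists (Phi : germ_map R[i]%C n.+1 n.+1) (k0 kinf : nat)
         (fs : 'I_k0 -> germ R[i]%C n) (gs : 'I_kinf -> germ R[i]%C n),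
    w_change Phi /\
    is_pullback f Phi
      (FracField.tofrac (w_monic fs) / FracField.tofrac (w_monic gs)).
Proof. exact: w_rational hf0 hnc. Qed.
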